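(* Let $(R,\mathfrak m)$ be either a Noetherian local ring with infinite residue field $k$, or a homogeneous algebra over an infinite field $k$ with irrelevant maximal ideal $\mathfrak m$, and let $M$ be in $\mathcal M(R)$. Then $$\mathrm{bdeg}(M)\le \mathrm{bdeg}(\mathrm{gr}_{\mathfrak m}(M)).$$
   Context: A homogeneous $k$-algebra is a graded ring $R=\bigoplus_{i\ge 0}R_{\langle i\rangle}$ with $R_{\langle 0\rangle}=k$, $\dim_k R_{\langle 1\rangle}<\infty$, and $R=k[R_{\langle 1\rangle}]$; its irrelevant maximal ideal is $\mathfrak m=\bigoplus_{i\ge1}R_{\langle i\rangle}$. $\mathcal M(R)$ is the category of finitely generated $R$-modules (finitely generated graded $R$-modules if $R$ is homogeneous). $\ell$ is length, $\Gamma_{\mathfrak m}(M)=\{z\in M: \mathfrak m^t z=0 \text{ for } t\gg0\}$, and $\deg(M)$ is the multiplicity of $M$ with respect to $\mathfrak m$ ($=\ell(M)$ if $\dim M=0$). Notion of genericity. If $R$ is local, it is a function $U$ assigning to each isomorphism class of modules $M$ in $\mathcal M(R)$ a non-empty subset $U(M)\subseteq\mathfrak m\setminus\mathfrak m^2$ such that: (i) if $f-g\in\mathfrak m^2$ then $f\in U(M)\iff g\in U(M)$; (ii) the image of $U(M)$ in $\mathfrak m/\mathfrak m^2$ contains a nonempty Zariski-open subset; (iii) if $\mathrm{depth}(M)>0$, every $f\in U(M)$ is regular on $M$. If $R$ is homogeneous, $U(M)$ is a non-empty subset of $R_{\langle1\rangle}$ containing a nonempty Zariski-open subset of $R_{\langle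 1\rangle}$ and satisfying (iii). The extremal cohomological degree $\mathrm{bdeg}(-)$ is the unique function from isomorphism classes of $\mathcal M(R)$ to $\mathbf N$ for which there is a notion of genericity $U$ such that for all $M$: (1) $\mathrm{bdeg}(M)=\deg(M)$ if $M$ is Cohen-Macaulay; (2) if $L=\Gamma_{\mathfrak m}(M)$, then $\mathrm{bdeg}(M)=\mathrm{bdeg}(M/L)+\ell(L)$; (3) if $\mathrm{depth}(M)>0$ and $x\in U(M)$, then $\mathrm{bdeg}(M)=\mathrm{bdeg}(M/xM)$. (Such a function exists and is unique.) $\mathrm{gr}_{\mathfrak m}(M)=\bigoplus_{i\ge0}\mathfrak m^iM/\mathfrak m^{i+1}M$ is a finitely generated graded module over the homogeneous $k$-algebra $\mathrm{gr}_{\mathfrak m}(R)=\bigoplus_{i\ge 0}\mathfrak m^i/\mathfrak m^{i+1}$, and $\mathrm{bdeg}(\mathrm{gr}_{\mathfrak m}(M))$ is computed in $\mathcal M(\mathrm{gr}_{\mathfrak m}(R))$. *)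

(* Defs.v *)
From HB Require Import structures.
From mathcomp Require Import all_boot all_order all_algebra.
From mathcomp Require Import boolp classical_sets functions cardinality.
From mathcomp Require Import mpoly.

Set Implicit Arguments.
Unset Strict Implicit.
Unset Printing Implicit Defensive.

Import GRing.Theory.

Local Open Scope ring_scope.
Local Open Scope classical_set_scope.

Section Modules.
Variable R : comNzRingType.
Implicit Types (M : lmodType R) (I m : set R).

Definition submodule M (L : set M) : Prop :=
  L 0 /\ forall (a : R) (u v : M), L u -> L v -> L (a *: u + v).

Definition span M (S : set M) : set M :=
  [set z | forall L : set M, submodule L -> S `<=` L -> L z].

Definition fin_gen M (L : set M) : Prop :=
  exists s : seq M, L = span [set z | z \in s].

Definition ideal I : Prop := @submodule R^o I.

Definition noetherian : Prop := forall I, ideal I -> @fin_gen R^o I.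

Definition maximal_ideal I : Prop :=
  [/\ ideal I, ~ I 1 & forall J, ideal J -> ~ J 1 -> I `<=` J -> J = I].

Definition local_ring m : Prop := [set I | maximal_ideal I] = [set m].

Definition prime_ideal I : Prop :=
  [/\ ideal I, ~ I 1 & forall a b, I (a * b) -> I a \/ I b].

Definition smul I M (L : set M) : set M :=
  span [set z | exists a u, [/\ I a, L u & z = a *: u]].

(* I^n M; in particular I^0 M = M. *)
Definition pow_mod I M (n : nat) : set M := iter n (@smul I M) setT.

Definition pow_ideal I (n : nat) : set R := @pow_mod I R^o n.

Definition annihilator M : set R := [set a | forall z : M, a *: z = 0].

(* Gamma_m(M) *)
Definition torsion m M : set M :=
  [set z | exists t : nat, forall a, pow_ideal m t a -> a *: z = 0].

(* There is a chain of n strict inclusions of submodules between N and L. *)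
Definition submod_chain M (N L : set M) (n : nat) : Prop :=
  exists c : nat -> set M,
    [/\ forall i, (i <= n)%N -> [/\ submodule (c i), N `<=` c i & c i `<=` L]
      & forall i, (i < n)%N -> c i `<` c i.+1].

(* The length of the R-module L / N is n. *)
Definition has_length M (N L : set M) (n : nat) : Prop :=
  submod_chain N L n /\ ~ submod_chain N L n.+1.

Definition prime_chain M (n : nat) : Prop :=
  exists c : nat -> set R,
    [/\ forall i, (i <= n)%N -> prime_ideal (c i) /\ annihilator M `<=` c i
      & forall i, (i < n)%N -> c i `<` c i.+1].

(* Krull dimension; the zero module has no dimension in this sense. *)
Definition has_dim M (d : nat) : Prop :=
  prime_chain M d /\ ~ prime_chain M d.+1.

Definition regular M (x : R) : Prop := forall z : M, x *: z = 0 -> z = 0.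

(* The submodule (xs_0, ..., xs_(i-1)) M. *)
Definition seq_mod M (xs : seq R) (i : nat) : set M :=
  @smul [set a | a \in take i xs] M setT.

(* The usual requirement M <> (xs) M is omitted: for finitely generated M <> 0
   and xs in m it holds by Nakayama's lemma, and for M = 0 its omission gives
   the convention depth 0 = +oo. *)
Definition regular_seq M (xs : seq R) : Prop :=
  forall (i : nat) (z : M), (i < size xs)%N ->
    @seq_mod M xs i (xs`_i *: z) -> @seq_mod M xs i z.

Definition depth_ge m M (n : nat) : Prop :=
  exists xs : seq R,
    [/\ size xs = n, forall x, x \in xs -> m x & regular_seq M xs].

Definition has_depth m M (d : nat) : Prop :=
  depth_ge m M d /\ ~ depth_ge m M d.+1.

Definition zero_module M : Prop := forall z : M, z = 0.

Definition cohen_macaulay m M : Prop :=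
  zero_module M \/ exists2 d, has_dim M d & has_depth m M d.

Definition hilbert_samuel_poly m M (P : {poly rat}) : Prop :=
  exists n0 : nat, forall n, (n0 <= n)%N ->
    exists2 l : nat, has_length (@pow_mod m M n) setT l & l%:R = P.[n%:R].

(* deg(M) = e, the multiplicity of M with respect to m; deg(0) = 0. *)
Definition has_multiplicity m M (e : nat) : Prop :=
  (zero_module M /\ e = 0%N) \/
  exists d P, [/\ has_dim M d, hilbert_samuel_poly m M P
                & e%:R = (d`!)%:R * P`_d].

(* f induces an isomorphism M / L -> N. *)
Definition quotient_map M (N : lmodType R) (L : set M) (f : {linear M -> N}) :
    Prop :=
  range f = setT /\ [set z | f z = 0] = L.

Definition quotient_of M (N : lmodType R) (L : set M) : Prop :=
  exists f : {linear M -> N}, quotient_map L f.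

End Modules.

(* V is the internal direct sum of the additive subgroups A i. *)
Definition grading (I : eqType) (V : zmodType) (A : I -> set V) : Prop :=
  [/\ forall i, A i 0 /\ (forall u v, A i u -> A i v -> A i (u - v)),
      forall x, exists (s : seq I) (c : I -> V),
        (forall i, A i (c i)) /\ x = \sum_(i <- s) c i
    & forall (s : seq I) (c : I -> V), uniq s -> (forall i, A i (c i)) ->
        \sum_(i <- s) c i = 0 -> forall i, i \in s -> c i = 0].

Definition basis_of (k : fieldType) (V : lmodType k) (W : set V) (n : nat)
    (e : 'I_n -> V) : Prop :=
  W = range (fun c : 'I_n -> k => \sum_i c i *: e i) /\
  forall c : 'I_n -> k, \sum_i c i *: e i = 0 -> forall i, c i = 0.

(* The homogeneous components of R are the Rg i. *)
Definition homogeneous_algebra (k : fieldType) (R : comAlgType k)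
    (Rg : nat -> set R) : Prop :=
  [/\ grading Rg,
      forall i j a b, Rg i a -> Rg j b -> Rg (i + j)%N (a * b),
      Rg 0%N = range (fun c : k => c%:A),
      exists n (e : 'I_n -> R), basis_of (Rg 1%N) e
    & forall S : set R, S 1 -> (forall c a b, S a -> S b -> S (c *: a + b)) ->
        (forall a b, S a -> S b -> S (a * b)) -> Rg 1%N `<=` S -> S = setT].

Definition irrelevant (R : comNzRingType) (Rg : nat -> set R) : set R :=
  [set x | exists n (c : nat -> R),
     (forall i, Rg i (c i)) /\ x = \sum_(1 <= i < n) c i].

Record gmodType (R : comNzRingType) := GMod {
  gmod_sort :> lmodType R;
  gpart : int -> set gmod_sort
}.

Definition graded_module (R : comNzRingType) (Rg : nat -> set R)
    (M : gmodType R) : Prop :=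
  grading (@gpart R M) /\
  forall i j a z, Rg i a -> gpart j z -> @gpart R M (i%:Z + j) (a *: z).

Definition gquotient_of (R : comNzRingType) (M N : gmodType R) (L : set M) :
    Prop :=
  exists f : {linear M -> N},
    quotient_map L f /\ forall j, f @` (@gpart R M j) = @gpart R N j.

(* Subsets of affine space k^n. *)
Definition zariski_open (k : fieldType) (n : nat) (O : set ('I_n -> k)) :
    Prop :=
  exists S : set {mpoly k[n]}, O = [set c | exists2 F, S F & F.@[c] != 0].

Section CohomologicalDegree.
(* The local and the graded case share the axioms of bdeg.  The modules of the
   category are the A : Ob with C A, with underlying R-module um A, and
   quot A B L means that B is isomorphic to A / L within the category. *)
Variables (R : comNzRingType) (m : set R).
Variables (Ob : Type) (um : Ob -> lmodType R) (C : Ob -> Prop).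
Variable quot : forall A B : Ob, set (um A) -> Prop.

Definition iso_invariant (T : Type) (f : Ob -> T) : Prop :=
  forall A B, C A -> @quot A B [set 0] -> f A = f B.

Definition bdeg_axioms (U : Ob -> set R) (b : Ob -> nat) : Prop :=
  [/\ iso_invariant b,
      forall A, C A -> cohen_macaulay m (um A) ->
        has_multiplicity m (um A) (b A),
      forall A B, C A -> @quot A B (@torsion R m (um A)) ->
        exists2 l, has_length [set 0] (@torsion R m (um A)) l & b A = (b B + l)%N
    & forall A B x, C A -> depth_ge m (um A) 1 -> U A x ->
        @quot A B (range (fun z : um A => x *: z)) -> b A = b B].

(* Condition (iii) on a notion of genericity. *)
Definition generic_regular (U : Ob -> set R) : Prop :=
  forall A x, C A -> depth_ge m (um A) 1 -> U A x -> regular (um A) x.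

End CohomologicalDegree.

Section Local.
Variables (k : fieldType) (R : comNzRingType) (m : set R).
Variable pi : {rmorphism R -> k}.

Definition residue_map : Prop :=
  range pi = setT /\ [set a | pi a = 0] = m.

Definition module_cat (M : lmodType R) : Prop := @fin_gen R M setT.

(* The classes of the e i form a k-basis of m / m^2. *)
Definition cotangent_basis (n : nat) (e : 'I_n -> R) : Prop :=
  [/\ forall i, m (e i),
      forall x, m x -> exists a : 'I_n -> R,
        pow_ideal m 2 (x - \sum_i a i * e i)
    & forall a : 'I_n -> R, pow_ideal m 2 (\sum_i a i * e i) ->
        forall i, pi (a i) = 0].

(* The image of V in m / m^2 contains a nonempty Zariski-open subset. *)
Definition cotangent_generic (V : set R) : Prop :=
  exists n (e : 'I_n -> R) (O : set ('I_n -> k)),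
    [/\ cotangent_basis e, zariski_open O, O !=set0
      & forall a : 'I_n -> R, O (fun i => pi (a i)) ->
          exists2 x, V x & pow_ideal m 2 (x - \sum_i a i * e i)].

(* When R is a field, m = m^2 = 0 and there is no nonempty subset of m \ m^2;
   non-emptiness and openness are then not required, so that bdeg is still
   defined (it is the dimension of vector spaces). *)
Definition local_genericity (U : lmodType R -> set R) : Prop :=
  [/\ @iso_invariant R (lmodType R) id module_cat (@quotient_of R) _ U,
      forall M, module_cat M -> U M `<=` m `\` pow_ideal m 2,
      forall M f g, module_cat M -> m f -> m g -> pow_ideal m 2 (f - g) ->
        (U M f <-> U M g),
      m <> pow_ideal m 2 ->
        forall M, module_cat M -> U M !=set0 /\ cotangent_generic (U M)
    & @generic_regular R m (lmodType R) id module_cat U].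

Definition local_bdeg (b : lmodType R -> nat) : Prop :=
  exists2 U, local_genericity U &
    @bdeg_axioms R m (lmodType R) id module_cat (@quotient_of R) U b.

End Local.

Section Homogeneous.
Variables (k : fieldType) (R : comAlgType k) (Rg : nat -> set R).

Definition graded_module_cat (M : gmodType R) : Prop :=
  @fin_gen R M setT /\ graded_module Rg M.

(* V contains a nonempty Zariski-open subset of the k-space Rg 1. *)
Definition linear_generic (V : set R) : Prop :=
  exists n (e : 'I_n -> R) (O : set ('I_n -> k)),
    [/\ basis_of (Rg 1%N) e, zariski_open O, O !=set0
      & forall c, O c -> V (\sum_i c i *: e i)].

Definition graded_genericity (U : gmodType R -> set R) : Prop :=
  [/\ @iso_invariant R (gmodType R) (@gmod_sort R) graded_module_cat
        (@gquotient_of R) _ U,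
      forall M, graded_module_cat M ->
        [/\ U M !=set0, U M `<=` Rg 1%N & linear_generic (U M)]
    & @generic_regular R (irrelevant Rg) (gmodType R) (@gmod_sort R)
        graded_module_cat U].

Definition graded_bdeg (b : gmodType R -> nat) : Prop :=
  exists2 U, graded_genericity U &
    @bdeg_axioms R (irrelevant Rg) (gmodType R) (@gmod_sort R)
      graded_module_cat (@gquotient_of R) U b.

End Homogeneous.

(* A family of surjections F i -> A i with kernels F (i+1), that is, of
   isomorphisms F i / F (i+1) -> A i; only the values of s i on F i matter. *)
Definition graded_pieces (V W : zmodType) (F : nat -> set V) (A : nat -> set W)
    (s : nat -> V -> W) : Prop :=
  forall i,
    [/\ forall x y, F i x -> F i y -> s i (x + y) = s i x + s i y,
        s i @` F i = A i
      & forall x, F i x -> (s i x = 0 <-> F i.+1 x)].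

(* (G, Gg) is gr_m(R); s i sends an element of m^i to its class in
   m^i / m^(i+1), identified with the degree i component Gg i. *)
Definition assoc_graded_ring (R : comNzRingType) (m : set R)
    (G : comNzRingType) (Gg : nat -> set G) (s : nat -> R -> G) : Prop :=
  [/\ grading Gg,
      graded_pieces (pow_ideal m) Gg s,
      s 0%N 1 = 1
    & forall i j a b, pow_ideal m i a -> pow_ideal m j b ->
        s i a * s j b = s (i + j)%N (a * b)].

(* Given G = gr_m(R) through s, N is the G-module gr_m(M); t i sends an element
   of m^i M to its class in m^i M / m^(i+1) M. *)
Definition assoc_graded_module (R : comNzRingType) (m : set R)
    (G : comNzRingType) (s : nat -> R -> G) (M : lmodType R) (N : gmodType G)
    (t : nat -> M -> N) : Prop :=
  [/\ grading (@gpart G N),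
      forall j, @gpart G N (Negz j) = [set 0],
      graded_pieces (@pow_mod R m M) (fun j : nat => @gpart G N j%:Z) t
    & forall i j a z, pow_ideal m i a -> @pow_mod R m M j z ->
        s i a *: t j z = t (i + j)%N (a *: z)].

(* Main.v *)
(* Write sat K for the set of z with m^t z in K for some t, so that
   Gamma_m(M / K) = sat K / K, and let in K be the initial submodule of K in
   gr M, so that gr (M / K) = gr M / in K.  We show
   bdeg (M / K) <= bdeg (gr M / in K) by Noetherian induction on K, starting
   from large K.

   If K <> sat K, the initial submodules of a chain from K to sat K form a strict
   chain inside sat (in K), by Krull's intersection theorem and the finite length
   of sat K / K; hence passing from K to sat K lowers the right-hand side at least
   as much as the left-hand side.

   If K = sat K <> M, choose x generic for M / K such that its initial form y is
   generic for gr M / sat (in K).  The left-hand side is bdeg (M / (K + x M)), and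
   in (K + x M) / (in K + y gr M) has finite length because y is regular modulo
   sat (in K); finite lengths only lower bdeg, so that
   bdeg (gr M / in (K + x M)) <= bdeg (gr M / in K). *)

From HB Require Import structures.
From mathcomp Require Import all_boot all_order all_algebra.
From mathcomp Require Import boolp classical_sets functions cardinality.
From mathcomp Require Import mpoly.
Require Import Defs.

Set Implicit Arguments.
Unset Strict Implicit.
Unset Printing Implicit Defensive.

Import Order.TTheory GRing.Theory Num.Theory.

Local Open Scope ring_scope.
Local Open Scope classical_set_scope.

(** * Submodules *)

(** The obstacle is that in K need not be saturated when K is. The initial form y of x can therefore
    be required to be regular only modulo sat (in K), and in (K + x M) may be larger than in K + y
    gr M. All estimates go through the common saturation of in K + y gr M, sat (in K) + y gr M and
    in (K + x M), and lengths are compared by counting chains of submodules.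

    With M and gr M fixed and K varying, bdeg becomes a function on submodules, and gr (M / K)
    enters only as gr M / in K. The finite length of sat K / K comes from the torsion axiom of bdeg
    itself. In a homogeneous algebra 1 - a need not be invertible for a in m, so Krull's theorem is
    applied to the m-torsion of M / K alone, which treats both cases at once. The infinite field
    serves to choose x: the coordinates of its initial form must meet one open condition coming from
    M / K and another coming from gr M / sat (in K). *)

Section Submodules.
Variables (R : comNzRingType) (M : lmodType R).
Implicit Types (A B L : set M) (I : set R) (x y z : M).

Definition sum_set A B : set M :=
  [set z | exists a b, [/\ A a, B b & z = a + b]].

Definition scale_set (r : R) : set M := range (fun z : M => r *: z).

Lemma submodule0 L : submodule L -> L 0.
Proof. by case. Qed.

Lemma submoduleD L x y : submodule L -> L x -> L y -> L (x + y).
Proof. by case=> _ HL Lx Ly; rewrite -[x]scale1r; apply: HL. Qed.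

Lemma submoduleZ L r x : submodule L -> L x -> L (r *: x).
Proof. by case=> L0 HL Lx; rewrite -[r *: x]addr0; apply: HL. Qed.

Lemma submoduleN L x : submodule L -> L x -> L (- x).
Proof. by move=> sL Lx; rewrite -scaleN1r; apply: submoduleZ. Qed.

Lemma submoduleB L x y : submodule L -> L x -> L y -> L (x - y).
Proof. by move=> sL Lx Ly; apply: submoduleD => //; apply: submoduleN. Qed.

Lemma submodule_sum L (T : Type) [s : seq T] (P : pred T) (F : T -> M) :
  submodule L -> (forall i, P i -> L (F i)) -> L (\sum_(i <- s | P i) F i).
Proof.
move=> sL HF; elim/big_ind: _ => //; first exact: submodule0.
by move=> x y; apply: submoduleD.
Qed.

Lemma submodule_set0 : submodule [set (0 : M)].
Proof. by split=> // r u v /= -> ->; rewrite scaler0 addr0. Qed.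

Lemma submoduleI A B : submodule A -> submodule B -> submodule (A `&` B).
Proof.
move=> [A0 HA] [B0 HB]; split=> // r u v [? ?] [? ?].
by split; [apply: HA | apply: HB].
Qed.

Lemma submodule_sum_set A B :
  submodule A -> submodule B -> submodule (sum_set A B).
Proof.
move=> [A0 HA] [B0 HB]; split; first by exists 0, 0; rewrite addr0.
move=> r _ _ [a [b [Aa Bb ->]]] [a' [b' [Aa' Bb' ->]]].
exists (r *: a + a'), (r *: b + b'); split; [exact: HA | exact: HB |].
by rewrite scalerDr addrACA.
Qed.

Lemma sub_sum_setl A B : submodule B -> A `<=` sum_set A B.
Proof. by move=> /submodule0 B0 a Aa; exists a, 0; rewrite addr0. Qed.

Lemma sub_sum_setr A B : submodule A -> B `<=` sum_set A B.
Proof. by move=> /submodule0 A0 b Bb; exists 0, b; rewrite add0r. Qed.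

Lemma sum_set_min A B L :
  submodule L -> A `<=` L -> B `<=` L -> sum_set A B `<=` L.
Proof.
by move=> sL AL BL _ [a [b [/AL ? /BL ? ->]]]; apply: submoduleD.
Qed.

Lemma sum_setS A A' B B' :
  A `<=` A' -> B `<=` B' -> sum_set A B `<=` sum_set A' B'.
Proof. by move=> AA' BB' _ [a [b [/AA' ? /BB' ? ->]]]; exists a, b. Qed.

Lemma submodule_scale_set r : submodule (scale_set r).
Proof.
split; first by exists 0; rewrite ?scaler0.
move=> c _ _ [u _ <-] [v _ <-]; exists (c *: u + v) => //.
by rewrite scalerDr !scalerA mulrC.
Qed.

Lemma submodule_span (S : set M) : submodule (span S).
Proof.
split=> [L [] //|r u v Su Sv L sL SL].
by case: (sL) => _; apply; [apply: Su | apply: Sv].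
Qed.

Lemma sub_span (S : set M) : S `<=` span S.
Proof. by move=> z Sz L _; apply. Qed.

Lemma span_min (S : set M) L : submodule L -> S `<=` L -> span S `<=` L.
Proof. by move=> sL SL z; apply. Qed.

Lemma submodule_smul I L : submodule (smul I L).
Proof. exact: submodule_span. Qed.

Lemma mem_smul I L r z : I r -> L z -> smul I L (r *: z).
Proof. by move=> Ir Lz; apply: sub_span; exists r, z. Qed.

Lemma smul_min I L L' :
  submodule L' -> (forall r z, I r -> L z -> L' (r *: z)) -> smul I L `<=` L'.
Proof.
by move=> sL' H; apply: span_min => // _ [r [z [Ir Lz ->]]]; apply: H.
Qed.

Lemma submodule_pow_mod I n : submodule (pow_mod I n : set M).
Proof. by case: n => [//|n]; apply: submodule_smul. Qed.

Lemma mem_pow_modS I n r z :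
  I r -> (pow_mod I n : set M) z -> (pow_mod I n.+1 : set M) (r *: z).
Proof. exact: mem_smul. Qed.

Lemma pow_modS_sub I n : (pow_mod I n.+1 : set M) `<=` pow_mod I n.
Proof.
by apply: smul_min => [|r z _]; [| apply: submoduleZ]; apply: submodule_pow_mod.
Qed.

Lemma pow_mod_sub I n p :
  (n <= p)%N -> (pow_mod I p : set M) `<=` pow_mod I n.
Proof.
move=> /subnK <-; elim: (p - n)%N => [//|q IH].
by apply: subset_trans IH; apply: pow_modS_sub.
Qed.

(** The colon submodule L :_M r. *)
Definition scale_preim (r : R) L : set M := [set z | L (r *: z)].

Lemma submodule_scale_preim r L : submodule L -> submodule (scale_preim r L).
Proof.
move=> sL; split; first by rewrite /scale_preim /= scaler0; apply: submodule0.
move=> c u v Lu Lv; rewrite /scale_preim /= scalerDr scalerA mulrC -scalerA.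
by apply: submoduleD => //; apply: submoduleZ.
Qed.

(** The colon ideal L : z, the annihilator of z modulo L. That an ideal carries z into L is proved
    as an inclusion into this ideal, which reduces it to generators. *)
Definition transporter z L : set R := [set r | L (r *: z)].

Lemma ideal_transporter z L : submodule L -> ideal (transporter z L).
Proof.
move=> sL; split; first by rewrite /transporter /= scale0r; apply: submodule0.
move=> c u v Lu Lv; rewrite /transporter /= scalerDl -scalerA.
by apply: submoduleD => //; apply: submoduleZ.
Qed.

Lemma fin_genP (s : seq M) z :
  span [set y | y \in s] z <-> exists c : nat -> R, z = \sum_(i < size s) c i *:
    s`_i.
Proof.
split.
  pose L := [set y | exists c : nat -> R, y = \sum_(i < size s) c i *: s`_i].
  apply: (@span_min _ L) => [|y /= ys].
    split; first by exists (fun=> 0); rewrite big1// => i _; rewrite scale0r.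
    move=> r _ _ [c ->] [d ->]; exists (fun i => r * c i + d i).
    rewrite scaler_sumr -big_split /=; apply: eq_bigr => i _.
    by rewrite scalerDl scalerA.
  have ys' : (index y s < size s)%N by rewrite index_mem.
  exists (fun i => (i == index y s)%:R).
  rewrite (bigD1 (Ordinal ys')) //= eqxx scale1r nth_index// big1 ?addr0//.
  move=> i; rewrite -val_eqE /= => /negbTE ->; by rewrite scale0r.
move=> [c ->]; have sS := @submodule_span [set y | y \in s].
apply: (submodule_sum sS) => i _; apply: (submoduleZ _ sS).
by apply: sub_span; apply: mem_nth.
Qed.

End Submodules.

Arguments scale_set {R} M r.

Section Powers.
Variable R : comNzRingType.
Implicit Types (I : set R) (M : lmodType R).

Lemma ideal_pow I n : ideal (pow_ideal I n).
Proof. exact: submodule_pow_mod. Qed.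

Lemma idealM I r a : ideal I -> I a -> I (r * a).
Proof. by move=> sI; apply: (@submoduleZ R R^o I r a). Qed.

Lemma mem_pow1 I a : I a -> pow_ideal I 1 a.
Proof. by move=> Ia; rewrite -[a]mulr1; apply: (@mem_smul R R^o). Qed.

Lemma pow1_mem I a : ideal I -> pow_ideal I 1 a -> I a.
Proof.
move=> sI; apply: (@smul_min R R^o) => // r z Ir _.
by rewrite /GRing.scale /= mulrC; apply: idealM.
Qed.

Lemma pow_mod_scale I M i j a (z : M) :
  pow_ideal I i a -> (pow_mod I j : set M) z ->
  (pow_mod I (i + j) : set M) (a *: z).
Proof.
move=> + Iz; elim: i a => [|i IH] a.
  by move=> _; apply: submoduleZ => //; apply: submodule_pow_mod.
suff: pow_ideal I i.+1 `<=` transporter z (pow_mod I (i.+1 + j)) by apply.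
apply: (@smul_min R R^o).
  by apply: ideal_transporter; apply: submodule_pow_mod.
move=> r b Ir Ib; rewrite /transporter /= -scalerA.
by apply: mem_pow_modS => //; apply: IH.
Qed.

(** The products a * b generate I^(i+j): peeling a factor r off I^(i+1) replaces Z by the colon
    ideal Z : r, so the induction is over all Z. *)
Lemma pow_ideal_add_min I i j (Z : set R) : ideal Z ->
  (forall a b, pow_ideal I i a -> pow_ideal I j b -> Z (a * b)) ->
  pow_ideal I (i + j) `<=` Z.
Proof.
elim: i Z => [|i IH] Z sZ H.
  by move=> b Ib; rewrite -[b]mul1r; apply: H.
apply: (@smul_min R R^o) => // r z Ir; apply: IH (scale_preim (r : R) (Z :
  set R^o)) _ _ _.
  exact: (@submodule_scale_preim R R^o).
move=> a b Ia Ib; rewrite /scale_preim /= /GRing.scale /= mulrA.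
by apply: H => //; apply: (@mem_pow_modS R R^o).
Qed.

End Powers.

(** * Noetherian modules *)

Section NoetherianModules.
Variables (R : comNzRingType).
Implicit Types (M : lmodType R) (m : set R).

Definition noetherian_module M : Prop :=
  forall L : set M, submodule L -> fin_gen L.

Lemma span_line M (z y : M) : span [set z] y <-> range (fun r : R => r *: z) y.
Proof.
split=> [|[r _ <-]]; last first.
  by apply: (submoduleZ _ (@submodule_span R M [set z])); apply: sub_span.
apply: (@span_min R M _ (range (fun r : R => r *: z))).
  split=> [|r _ _ [a _ <-] [b _ <-]]; first by exists 0; rewrite ?scale0r.
  by exists (r * a + b); rewrite // scalerDl scalerA.
by move=> _ ->; exists 1; rewrite ?scale1r.
Qed.

(** Induction on the number of generators. For generators z and s, the coefficients of z in elements
    of L form an ideal; lifts of its generators, together with generators of the intersection of L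
    with the span of s, generate L. *)
Lemma noetherian_fin_gen M :
  noetherian R -> @fin_gen R M setT -> noetherian_module M.
Proof.
move=> nR [s0 Hs0]; suff H (s : seq M) (L : set M) :
    submodule L -> L `<=` span [set z | z \in s] -> fin_gen L.
  by move=> L sL; apply: (H s0) => //; rewrite -Hs0.
elim: s L => [|z s IH] L sL Ls.
  exists [::]; apply/seteqP; split=> //; apply: span_min => //.
pose S := span [set y | y \in s]; have sS : submodule S by apply:
  submodule_span.
pose I := [set r | exists2 y, S y & L (r *: z + y)].
have sI : ideal I.
  split; first by exists 0; [apply: (submodule0 sS) | rewrite scale0r addr0;
    apply: submodule0].
  move=> c u v [y Sy Ly] [y' Sy' Ly']; exists (c *: y + y').
    by apply: (submoduleD sS) => //; apply: (submoduleZ _ sS).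
  rewrite [c *: u]/(c * u) scalerDl -scalerA addrACA -scalerDr.
  by apply: submoduleD => //; apply: submoduleZ.
have [a Ia] := nR _ sI.
have [t Lt] : fin_gen (L `&` S) by apply: IH => [|y []//]; apply: submoduleI.
have /choice[y Hy] (i : 'I_(size a)) : exists y, S y /\ L (a`_i *: z + y).
  have: I a`_i by rewrite Ia; apply: sub_span; apply: mem_nth.
  by case=> y; exists y.
pose l := codom (fun i : 'I_(size a) => a`_i *: z + y i).
exists (l ++ t); apply/seteqP; split=> [x Lx|]; last first.
  apply: span_min => // x /=; rewrite mem_cat => /orP[/codomP[i ->]|xt].
    by case: (Hy i).
  have: (L `&` S) x by rewrite Lt; apply: sub_span.
  by case.
have sG := @submodule_span R M [set z | z \in l ++ t].
have [r [w Sw def_x]] : exists r, exists2 w, S w & x = r *: z + w.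
  have [c ->] := iffLR (fin_genP _ _) (Ls _ Lx).
  rewrite big_ord_recl /=; exists (c 0%N), (\sum_(i < size s) c i.+1 *: s`_i) =>
    //.
  apply: (submodule_sum sS) => i _; apply: (submoduleZ _ sS).
  by apply: sub_span; apply: mem_nth.
have Ir : I r by exists w; rewrite -?def_x.
have [c def_r] : exists c : nat -> R, r = \sum_(i < size a) c i * a`_i.
  by move: Ir; rewrite Ia => /fin_genP.
pose v := \sum_(i < size a) c i *: (a`_i *: z + y i).
have Lv : L v.
  by apply: (submodule_sum sL) => i _; apply: (submoduleZ _ sL); case: (Hy i).
rewrite -(subrK v x); apply: (submoduleD sG).
  suff: (L `&` S) (x - v).
    rewrite Lt; apply: span_min => // q qt; apply: sub_span => /=.
    by rewrite mem_cat qt orbT.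
  split; first exact: submoduleB.
  rewrite def_x /v; under eq_bigr do rewrite scalerDr scalerA.
  rewrite big_split /= -scaler_suml -def_r opprD addrACA subrr add0r.
  apply: (submoduleB sS) => //; apply: (submodule_sum sS) => i _.
  by apply: (submoduleZ _ sS); case: (Hy i).
apply: (submodule_sum sG) => i _; apply: (submoduleZ _ sG).
apply: sub_span => /=; rewrite mem_cat.
by rewrite (codom_f (fun i : 'I_(size a) => a`_i *: z + y i)).
Qed.

(** A failure at K0 would start, by choice, an infinite strictly increasing chain of failures; its
    union is finitely generated, hence equal to one of its members. *)
Lemma noeth_ind M (P : set M -> Prop) : noetherian_module M ->
  (forall K, submodule K ->
     (forall K', submodule K' -> K `<` K' -> P K') -> P K) ->
  forall K, submodule K -> P K.
Proof.
move=> nM IH K0 sK0; apply: contrapT => nP0.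
pose bad K := submodule K /\ ~ P K.
have /choice[g Hg] (K : set M) : exists K', bad K -> bad K' /\ K `<` K'.
  have [bK|] := pselect (bad K); last by exists K.
  apply: contrapT => nK; case: (bK) => sK; apply; apply: IH => // K' sK' KK'.
  by apply: contrapT => nP; apply: nK; exists K'.
pose c n := iter n g K0.
have bc n : bad (c n) by elim: n => [//|n /Hg[]].
have cS n : c n `<` c n.+1 by case: (Hg _ (bc n)).
have c_le n p : (n <= p)%N -> c n `<=` c p.
  move=> /subnK <-; elim: (p - n)%N => [//|q IHq].
  by apply: subset_trans IHq _; case: (cS (q + n)%N).
have sU : submodule (\bigcup_n c n).
  split; first by exists 0%N => //; apply: submodule0.
  move=> r u v [i _ ui] [j _ vj]; exists (maxn i j) => //.
  case: (bc (maxn i j)) => -[_ H] _; apply: H.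
    exact: c_le (leq_maxl _ _) _ ui.
  exact: c_le (leq_maxr _ _) _ vj.
have [s Us] := nM _ sU.
have [n Hn] : exists n, forall z, z \in s -> c n z.
  have : forall z, z \in s -> (\bigcup_n c n) z by move=> z zs; rewrite Us;
    apply: sub_span.
  elim: (s) => [_|z s' IHs Hs]; first by exists 0%N.
  have [i _ zi] := Hs z (mem_head _ _).
  have [j Hj] : exists n, forall z, z \in s' -> c n z.
    by apply: IHs => y ys; apply: Hs; rewrite inE ys orbT.
  exists (maxn i j) => y; rewrite inE => /predU1P[->|/Hj].
    exact: c_le (leq_maxl _ _) _ zi.
  exact: c_le (leq_maxr _ _) _.
have [_] := cS n; apply; apply: subset_trans (_ : \bigcup_n c n `<=` _).
  by move=> z cz; exists n.+1.
by rewrite Us; apply: span_min => //; case: (bc n).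
Qed.

Lemma noeth_max M (Q : set M -> Prop) K0 : noetherian_module M ->
  submodule K0 -> Q K0 ->
  exists K, [/\ submodule K, Q K &
    forall K', submodule K' -> Q K' -> K `<=` K' -> K' = K].
Proof.
move=> nM; move: K0; apply: (noeth_ind (P := fun K => Q K -> _) nM).
move=> K sK IH QK.
have [[K' [sK' QK' KK']]|H] :=
    pselect (exists K', [/\ submodule K', Q K' & K `<` K']).
  exact: IH QK'.
exists K; split=> // K' sK' QK' KK'; apply: contrapT => K'K; apply: H.
exists K'; split=> //; rewrite properEneq; split=> //.
by apply/eqP => E; apply: K'K.
Qed.

Lemma noeth_acc M (F : nat -> set M) : noetherian_module M ->
  (forall n, submodule (F n)) -> (forall n, F n `<=` F n.+1) ->
  exists n0, forall n, F n `<=` F n0.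
Proof.
move=> nM sF FS.
have F_le n p : (n <= p)%N -> F n `<=` F p.
  move=> /subnK <-; elim: (p - n)%N => [//|q IHq].
  by apply: subset_trans IHq _; apply: FS.
have rF n : range F (F n) by exists n.
have [_ [_ [n0 _ <-] H]] := noeth_max nM (sF 0%N) (rF 0%N).
exists n0 => n; apply: subset_trans (F_le _ _ (leq_maxl n n0)) _.
by rewrite (H _ (sF _) (rF (maxn n n0))) //; apply: F_le; apply: leq_maxr.
Qed.

(** If L is nonzero, it has a maximal proper submodule K. Some a y with a in m lies outside K, so z
    is in K + R a y and y is in K + R z for any z in L outside K; then (1 - r r' a) z is in K and
    the factor is invertible. *)
Lemma nakayama M m (L : set M) : noetherian_module M -> ideal m ->
  (forall a, m a -> exists u : R, u * (1 - a) = 1) ->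
  submodule L -> L `<=` smul m L -> L `<=` [set 0].
Proof.
move=> nM sm m_unit sL mL; apply: contrapT => nL0.
have [K [sK [KL nLK] maxK]] : exists K, [/\ submodule K, K `<=` L /\ ~ L `<=` K
    & forall K', submodule K' -> K' `<=` L /\ ~ L `<=` K' -> K `<=` K' ->
      K' = K].
  apply: (noeth_max (Q := fun K => K `<=` L /\ ~ L `<=` K)
    nM (@submodule_set0 R M)).
  by split=> // _ ->; apply: (submodule0 sL).
have Kmax (B : set M) : submodule B -> B `<=` L -> ~ B `<=` K -> L `<=`
  sum_set K B.
  move=> sB BL nBK; apply: contrapT => nT; apply: nBK.
  rewrite -(maxK (sum_set K B)); first exact: sub_sum_setr.
  - exact: submodule_sum_set.
  - by split=> //; apply: sum_set_min.
  - exact: sub_sum_setl.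
have [z Lz nKz] : exists2 z, L z & ~ K z.
  by apply: contrapT => H; apply: nLK => z Lz; apply: contrapT => nKz; apply: H;
    exists z.
have [a ma [y Ly nKay]] : exists2 a, m a & exists2 y, L y & ~ K (a *: y).
  apply: contrapT => H; apply: nLK; apply: subset_trans mL _.
  apply: smul_min => // r y mr Ly; apply: contrapT => nry.
  by apply: H; exists r => //; exists y.
have span_L w : L w -> span [set w] `<=` L by move=> Lw;
  apply: span_min => // _ ->.
have sspan w := @submodule_span R M [set w].
have [x [_ [Kx /span_line[r _ <-] Ez]]] : sum_set K (span [set a *: y]) z.
  apply: Kmax Lz => //; first by apply: span_L; apply: (submoduleZ _ sL).
  by move=> H; apply: nKay; apply: H; apply: sub_span.
have [x' [_ [Kx' /span_line[r' _ <-] Ey]]] : sum_set K (span [set z]) y.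
  apply: Kmax Ly => //; first exact: span_L.
  by move=> H; apply: nKz; apply: H; apply: sub_span.
have [v Ev] : exists v : R, v * (1 - (r * r') * a) = 1.
  by apply: m_unit; apply: idealM.
apply: nKz; rewrite -[z]scale1r -Ev -scalerA; apply: (submoduleZ _ sK).
have -> : (1 - r * r' * a) *: z = x + (r * a) *: x'.
  rewrite scalerBl scale1r {1}Ez Ey !scalerDr !scalerA mulrAC addrA addrK.
  by [].
by apply: (submoduleD sK) => //; apply: (submoduleZ _ sK).
Qed.

(** Noetherian induction on X: some z outside X satisfies m z in X, the claim for X + R z gives an
    n, and one more factor from m absorbs the multiples of z. *)
Lemma pow_mod_nilp M (as_ : seq R) m (X : set M) : noetherian_module M ->
  m = @span R R^o [set a | a \in as_] -> submodule X ->
  (forall a, m a -> exists n, forall z : M, X (a ^+ n *: z)) ->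
  exists n, (pow_mod m n : set M) `<=` X.
Proof.
move=> nM def_m; move: X; apply: (noeth_ind (P := fun X => _ -> _) nM) =>
  X sX IH nilX.
have [XT|/existsNP[z0 nz0]] := pselect (forall z, X z); first by exists 0%N.
(* The generators are treated one at a time: z is multiplied by the last power of the generator that
   keeps it outside X. *)
have [z nz Hz] : exists2 z, ~ X z & forall a, a \in as_ -> X (a *: z).
  have : forall a, a \in as_ -> m a by rewrite def_m => a; apply: sub_span.
  elim: (as_) => [_|a s IHs Hs]; first by exists z0.
  have [z nz Hz] : exists2 z, ~ X z & forall a, a \in s -> X (a *: z).
    by apply: IHs => b bs; apply: Hs; rewrite inE bs orbT.
  have [n Hn] := nilX a (Hs a (mem_head _ _)).
  have := Hn z; elim: n {Hn} => [|n IHn]; first by rewrite expr0 scale1r.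
  have [/IHn //|nX] := pselect (X (a ^+ n *: z)); rewrite exprS -scalerA => Xa.
  exists (a ^+ n *: z) => // b; rewrite inE => /predU1P[->//|/Hz Xb].
  by rewrite scalerA mulrC -scalerA; apply: (submoduleZ _ sX).
have sz := @submodule_span R M [set z].
have XX' : X `<=` sum_set X (span [set z]) by apply: sub_sum_setl.
have [|||n Hn] := IH (sum_set X (span [set z])).
- exact: submodule_sum_set.
- split=> // H; apply: nz; apply: H; apply: sub_sum_setr => //.
  exact: sub_span.
- by move=> a /nilX[n Hn]; exists n => y; apply: XX'.
exists n.+1; apply: smul_min => // a y ma /Hn[x [_ [Xx /span_line[r _ <-] ->]]].
rewrite scalerDr; apply: (submoduleD sX); first exact: (submoduleZ _ sX).
rewrite scalerA mulrC -scalerA; apply: (submoduleZ _ sX).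
suff: m `<=` transporter z X by apply.
by rewrite def_m; apply: (@span_min R R^o _ (transporter z X)) => //;
  exact: ideal_transporter.
Qed.

Definition sat m M (L : set M) : set M :=
  [set z | exists t, forall a, pow_ideal m t a -> L (a *: z)].

Lemma sub_sat m M (L : set M) : submodule L -> L `<=` sat m L.
Proof. by move=> sL z Lz; exists 0%N => a _; apply: (submoduleZ _ sL). Qed.

Lemma satS m M (L L' : set M) : L `<=` L' -> sat m L `<=` sat m L'.
Proof. by move=> LL' z [t H]; exists t => a /H /LL'. Qed.

Lemma submodule_sat m M (L : set M) : submodule L -> submodule (sat m L).
Proof.
move=> sL; split; first by exists 0%N => a _; rewrite scaler0;
  apply: (submodule0 sL).
move=> r u v [i Hi] [j Hj]; exists (maxn i j) => a ma.
rewrite scalerDr scalerA mulrC -scalerA; apply: (submoduleD sL).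
  apply: (submoduleZ _ sL); apply: Hi.
  exact: (@pow_mod_sub R R^o m _ _ (leq_maxl i j)).
by apply: Hj; apply: (@pow_mod_sub R R^o m _ _ (leq_maxr i j)).
Qed.

(** m^t is finitely generated, so a single exponent u works for all its generators, and m^(u+t)
    carries z into L. *)
Lemma sat_sat m M (L : set M) : noetherian R -> submodule L ->
  sat m (sat m L) `<=` sat m L.
Proof.
move=> nR sL z [t Ht]; have [s Hs] := nR _ (ideal_pow m t).
have [u Hu] : exists u, forall a b, a \in s -> pow_ideal m u b -> L (b *: (a *:
  z)).
  have : forall a, a \in s -> sat m L (a *: z).
    by move=> a sa; apply: Ht; rewrite Hs; apply: sub_span.
  elim: (s) => [|a s' IH] Hsat; first by exists 0%N.
  have [i Hi] := Hsat a (mem_head _ _).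
  have [j Hj] : exists u, forall a b, a \in s' -> pow_ideal m u b -> L (b *:
    (a *: z)).
    by apply: IH => b bs; apply: Hsat; rewrite inE bs orbT.
  exists (maxn i j) => c b; rewrite inE => /predU1P[->|cs] mb.
    by apply: Hi; apply: (@pow_mod_sub R R^o m _ _ (leq_maxl i j)).
  by apply: Hj => //; apply: (@pow_mod_sub R R^o m _ _ (leq_maxr i j)).
exists (u + t)%N; apply: pow_ideal_add_min (ideal_transporter z sL) _ =>
  b a mb ma.
rewrite /transporter /= -scalerA.
suff: pow_ideal m t `<=` transporter z (scale_preim b L) by apply.
rewrite Hs; apply: (@span_min R R^o _ (transporter z (scale_preim b L))) =>
  [|c cs].
  exact/ideal_transporter/submodule_scale_preim.
exact: Hu.
Qed.

(* Krull's intersection theorem for the m-torsion part of M / K, where torsion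
   takes the place of Nakayama's lemma. *)
Lemma sat_pow_mod_inter m M (K : set M) z :
  noetherian R -> noetherian_module M -> ideal m -> submodule K ->
  sat m K z -> (forall n, sum_set K (pow_mod m n) z) -> K z.
Proof.
move=> nR nM sm sK; set D := sat m K => Dz Pz.
(* For X maximal among the submodules that contain K and meet D only in K, it is enough that X
   contains some m^n M: then z lies in both X and D. *)
pose Q X := K `<=` X /\ X `&` D `<=` K.
have [X [sX [KX XD] maxX]] := @noeth_max M Q K nM sK (conj (@subset_refl _ K)
  (@subIsetl _ K D)).
have [s def_m] := nR _ sm.
have [n Hn] : exists n, (pow_mod m n : set M) `<=` X.
  apply: (pow_mod_nilp nM def_m sX) => a ma.
  have sF n : submodule (scale_preim (a ^+ n) X) by apply:
    submodule_scale_preim.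
  have FS n : scale_preim (a ^+ n) X `<=` scale_preim (a ^+ n.+1) X.
    by move=> u Xu; rewrite /scale_preim /= exprS -scalerA;
      apply: (submoduleZ _ sX).
  have [n0 Hn0] := noeth_acc nM sF FS.
  have sa := @submodule_scale_set R M (a ^+ n0).
  have XX' : X `<=` sum_set X (scale_set M (a ^+ n0)) by apply: sub_sum_setl.
  (* By maximality of X it suffices that X + a^n0 M meets D inside K. If x + a^n0 y lies in D, some
     a^t carries it into K, so y lies in X : a^(t+n0), which is contained in X : a^n0. *)
  exists n0 => u; rewrite -(maxX (sum_set X (scale_set M (a ^+ n0)))) //.
  - by apply: sub_sum_setr => //; exists u.
  - exact: submodule_sum_set.
  split; first exact: subset_trans XX'.
  move=> _ [[x [_ [Xx [y _ <-] ->]]] Dy]; apply: XD; split=> //.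
  apply: (submoduleD sX) => //; case: (Dy) => t Ht.
  have at_m : pow_ideal m t (a ^+ t).
    elim: (t) => [|i IHi]; first by [].
    by rewrite exprS; apply: (@mem_pow_modS R R^o).
  have /KX := Ht _ at_m; rewrite scalerDr => H.
  apply: (Hn0 (t + n0)%N); rewrite /scale_preim /= exprD -scalerA.
  rewrite -[_ *: _](addKr (a ^+ t *: x)); apply: (submoduleD sX) => //.
  by apply/(submoduleN sX)/(submoduleZ _ sX).
apply: XD; split=> //; apply: (@sum_set_min R M K (pow_mod m n) X) => //.
Qed.

(** If a avoids the first n primes but lies in p n, it is corrected by c * b with b in m outside p
    n, and c outside p n but in every p i not contained in p n. For p i inside p n, avoiding p n is
    enough. *)
Lemma prime_avoidance m n (p : nat -> set R) : ideal m ->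
  (forall i, (i < n)%N -> prime_ideal (p i) /\ ~ m `<=` p i) ->
  exists2 a, m a & forall i, (i < n)%N -> ~ p i a.
Proof.
move=> sm; elim: n => [|n IH] Hp; first by exists 0 => //;
  apply: (submodule0 sm).
have [a ma Ha] : exists2 a, m a & forall i, (i < n)%N -> ~ p i a.
  by apply: IH => i /ltnW; apply: Hp.
have [pr_n nm] := Hp n (leqnn _).
have [pa|npa] := pselect (p n a); last first.
  by exists a => // i; rewrite ltnS leq_eqVlt => /predU1P[->|/Ha].
have [sn _ primen] := pr_n.
have [b mb nb] : exists2 b, m b & ~ p n b.
  by apply: contrapT => H; apply: nm => b mb; apply: contrapT => nb; apply: H;
    exists b.
have [c nc Hc] : exists2 c, ~ p n c & forall i, (i < n)%N -> p i `<=`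
  p n \/ p i c.
  have : forall i, (i < n)%N -> ideal (p i) by move=> i /ltnW /Hp[[]].
  move: (p n) nb sn primen pr_n => P nb sn primen pr_n.
  elim: n {IH Hp a ma Ha pa nm} => [|q IHq] ip.
    by exists 1 => //; case: pr_n.
  have [c nc Hc] : exists2 c, ~ P c & forall i, (i < q)%N -> p i `<=`
    P \/ p i c.
    by apply: IHq => i /ltnW; apply: ip.
  have [pq|npq] := pselect (p q `<=` P).
    exists c => // i; rewrite ltnS leq_eqVlt => /predU1P[->|/Hc//]; by left.
  have [d pd nd] : exists2 d, p q d & ~ P d.
    by apply: contrapT => H; apply: npq => d pd; apply: contrapT => nd;
      apply: H; exists d.
  exists (d * c) => [/primen[]//|i]; rewrite ltnS leq_eqVlt => /predU1P[->|iq].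
    by right; rewrite mulrC; apply: idealM => //; apply: ip.
  by case: (Hc i iq) => H; [left | right; apply: idealM => //; apply: ip;
    exact: ltnW].
exists (a + c * b); first by apply: (submoduleD sm) => //; apply: idealM.
move=> i; rewrite ltnS leq_eqVlt => /predU1P[->|lin] pab.
  have: p n (c * b) by rewrite -[c * b](addKr a) addrC; apply: (submoduleB sn).
  by case/primen.
have [[si _ _] _] := Hp i (ltnW lin); case: (Hc i lin) => [/(_ _ pab)|pc].
  move=> pn; have: p n (c * b) by rewrite -[c * b](addKr a) addrC;
    apply: (submoduleB sn).
  by case/primen.
apply: (Ha i lin); rewrite -[a](addrK (c * b)); apply: (submoduleB si) => //.
by rewrite mulrC; apply: idealM.
Qed.

Lemma regular_depth_ge1 M m x : m x -> regular M x -> depth_ge m M 1.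
Proof.
move=> mx rx; exists [:: x]; split=> // [y|[|//] z _].
  by rewrite mem_seq1 => /eqP ->.
rewrite /= => H; have: x *: z = 0.
  by apply: (@smul_min R M [set a | a \in take 0 [:: x]] setT [set 0]) H => //;
    apply: submodule_set0.
by move/rx ->; apply: (submodule0 (submodule_smul _ _)).
Qed.

(** Take K maximal among the submodules whose zero divisors are covered by finitely many primes not
    containing m, and x in m outside these primes. If x kills z <> 0, a maximal annihilator of a
    nonzero multiple w of z is prime, and it does not contain m because there is no torsion. Either
    R w meets K, where x is regular, or K + R w with one more prime contradicts the maximality of
    K. *)
Lemma depth_ge1_torsion M m : noetherian R -> noetherian_module M -> ideal m ->
  @torsion R m M `<=` [set 0] -> depth_ge m M 1.
Proof.
move=> nR nM sm tors0.
pose Q (K : set M) := exists n (p : nat -> set R),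
  (forall i, (i < n)%N -> prime_ideal (p i) /\ ~ m `<=` p i) /\
  forall a, (forall i, (i < n)%N -> ~ p i a) ->
    forall z, K z -> a *: z = 0 -> z = 0.
have Q0 : Q [set 0] by exists 0%N, (fun=> setT).
have [K [sK [n [p [Hp Kreg]]] maxK]] := noeth_max nM (@submodule_set0 R M) Q0.
have [x mx Hx] := prime_avoidance sm Hp.
apply: (regular_depth_ge1 mx) => z xz0; apply: contrapT => nz.
pose ann y := transporter y [set (0 : M)].
have sann y : ideal (ann y) by apply/ideal_transporter/submodule_set0.
pose A I := exists2 r : R, r *: z <> 0 & I = ann (r *: z).
have A1 : A (ann z) by exists 1; rewrite ?scale1r.
have [_ [_ [r nw ->] maxA]] := @noeth_max R^o A (ann z) nR (sann z) A1.
move Ew: (r *: z) nw maxA => w nw maxA.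
have pr_w : prime_ideal (ann w).
  split=> // [|b c]; first by rewrite /ann /transporter /= scale1r.
  rewrite /ann /transporter /= -scalerA => bcw.
  have [cw|ncw] := pselect (c *: w = 0); [by right | left].
  suff E : ann (c *: w) = ann w by rewrite -[_ = _]/(ann w b) -E.
  apply: maxA (sann _) _ _; first by exists (c * r); rewrite -scalerA Ew.
  by move=> d /= dw; rewrite /ann /transporter /= scalerA mulrC -scalerA dw
    scaler0.
have nmw : ~ m `<=` ann w.
  by move=> H; apply: nw; apply: tors0; exists 1%N => a /(pow1_mem sm) /H.
have sw := @submodule_span R M [set w].
have [[q nq Kq]|H] := pselect (exists2 q : R, q *: w <> 0 & K (q *: w)).
  apply: nq; apply: Kreg Hx _ Kq _.
  by rewrite -Ew !scalerA -mulrA mulrC -scalerA xz0 scaler0.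
suff E : sum_set K (span [set w]) = K.
  apply: H; exists 1; rewrite scale1r // -E; apply: sub_sum_setr => //.
  exact: sub_span.
apply: maxK; [exact: submodule_sum_set | | exact: sub_sum_setl].
exists n.+1, (fun i => if i == n then ann w else p i); split.
  by move=> i; rewrite ltnS leq_eqVlt; case: eqP => //= _; apply: Hp.
move=> a Ha _ [y [_ [Ky /span_line[q _ <-] ->]]].
have nwa : ~ ann w a by have := Ha n (leqnn _); rewrite eqxx.
have Hpa i : (i < n)%N -> ~ p i a.
  by move=> lin; have := Ha i (ltnW lin); rewrite ltn_eqF.
rewrite scalerDr => E.
have Kaq : K ((a * q) *: w).
  rewrite -scalerA -[_ *: _](addKr (a *: y)) E addr0.
  by apply/(submoduleN sK)/(submoduleZ _ sK).
have aqw : (a * q) *: w = 0 by apply: contrapT => aqw; apply: H; exists (a * q).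
have [_ _ primew] := pr_w; have [//|qw] := primew a q aqw.
rewrite [q *: w]qw addr0; apply: (Kreg a) => //.
by move: E; rewrite [q *: w]qw scaler0 addr0.
Qed.

End NoetherianModules.

(** * Lengths and quotients *)

Section Lengths.
Variables (R : comNzRingType) (M : lmodType R).
Implicit Types (A B K L N P T : set M).

Lemma submod_chainS N N' L L' n :
  N' `<=` N -> L `<=` L' -> submod_chain N L n -> submod_chain N' L' n.
Proof.
move=> N'N LL' [c [Hc Sc]]; exists c; split=> // i /Hc[si Ni iL].
by split=> //; [apply: subset_trans Ni | apply: subset_trans LL'].
Qed.

Lemma submod_chain0 N L A :
  submodule A -> N `<=` A -> A `<=` L -> submod_chain N L 0.
Proof. by move=> sA NA AL; exists (fun=> A). Qed.

Lemma submod_chain_le N L n p :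
  (p <= n)%N -> submod_chain N L n -> submod_chain N L p.
Proof.
move=> pn [c [Hc Sc]]; exists c; split=> i ip; first exact/Hc/(leq_trans ip).
exact/Sc/(leq_trans ip).
Qed.

Lemma submod_chain_extend N L L' n : submodule L' -> L `<` L' ->
  submod_chain N L n -> submod_chain N L' n.+1.
Proof.
move=> sL' [LL' nL'L] [c [Hc Sc]].
exists (fun i => if (i <= n)%N then c i else L'); split=> i.
  have [lin _|_ _] := leqP i n; last first.
    have [_ N0 L0] := Hc 0%N isT.
    by split=> //; apply: (subset_trans N0 (subset_trans L0 LL')).
  by have [? ? iL] := Hc i lin; split=> //; apply: subset_trans iL LL'.
rewrite ltnS; have [lin _|ni|-> _] := ltngtP i n.
- by apply: Sc.
- by [].
have [_ _ nL] := Hc n (leqnn n); split.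
  exact: subset_trans nL LL'.
by move=> H; apply: nL'L; apply: subset_trans H nL.
Qed.

Lemma submod_chain_cat N P L p q :
  submod_chain N P p -> submod_chain P L q -> submod_chain N L (p + q).
Proof.
move=> Np; elim: q L => [|q IH] L [c [Hc Sc]].
  have [_ P0 L0] := Hc 0%N isT.
  by rewrite addn0; apply: submod_chainS Np => //; apply: subset_trans L0.
rewrite addnS; have [sq _ qL] := Hc q.+1 (leqnn _).
apply: (@submod_chainS N _ (c q.+1)) => //.
apply: (@submod_chain_extend N (c q)) (Sc q (leqnn _)) _ => //.
apply: IH; exists c; split=> i iq; last by apply: Sc; rewrite ltnS ltnW.
have [si Pi _] := Hc i (leqW iq); split=> //.
have: (i <= q)%N := iq; elim: q {sq qL iq} Hc Sc => [|q IHq] Hc Sc.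
  by rewrite leqn0 => /eqP ->.
rewrite leq_eqVlt => /predU1P[->//|]; rewrite ltnS => iq.
have [cq _] := Sc q (leqW (leqnn _)); apply: subset_trans cq.
by apply: IHq => // j jq; [apply/Hc/leqW | apply/Sc/leqW].
Qed.

(** The chain is intersected with P and added to P. By the modular law each strict step stays strict
    in at least one of the two resulting chains. *)
Lemma submod_chain_split N P L n : submodule P -> submodule L -> N `<=` P ->
  P `<=` L ->
  submod_chain N L n ->
  exists p q, [/\ (n <= p + q)%N, submod_chain N P p & submod_chain P L q].
Proof.
move=> sP sL NP PL [c [Hc Sc]].
have sI i : (i <= n)%N -> submodule (c i `&` P).
  by move=> /Hc[si _ _]; apply: submoduleI.
have sD i : (i <= n)%N -> submodule (sum_set (c i) P).
  by move=> /Hc[si _ _]; apply: submodule_sum_set.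
suff H j : (j <= n)%N -> exists p q, [/\ (j <= p + q)%N,
    submod_chain N (c j `&` P) p & submod_chain P (sum_set (c j) P) q].
  have [p [q [npq Np Pq]]] := H n (leqnn n); have [sn _ nL] := Hc n (leqnn n).
  exists p, q; split=> //; first by apply: submod_chainS Np.
  by apply: submod_chainS Pq => //; apply: sum_set_min.
elim: j => [|j IH] jn.
  have [s0 N0 _] := Hc 0%N jn; exists 0%N, 0%N; split=> //.
    apply: (@submod_chain0 _ _ (c 0%N `&` P)) => //; first exact: sI.
    by move=> z Nz; split; [apply: N0 | apply: NP].
  apply: (@submod_chain0 _ _ (sum_set (c 0%N) P)) => //; first exact: sD.
  exact: sub_sum_setr.
have [p [q [jpq Np Pq]]] := IH (ltnW jn); have [cj njc] := Sc j jn.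
have [sj _ _] := Hc j (ltnW jn); have [sj1 _ _] := Hc j.+1 jn.
have cI : c j `&` P `<=` c j.+1 `&` P by move=> z [/cj ? ?].
have cD : sum_set (c j) P `<=` sum_set (c j.+1) P by apply: sum_setS.
have [H|H] := pselect (c j.+1 `&` P `<=` c j `&` P); last first.
  exists p.+1, q; split; first by rewrite addSn ltnS.
    by apply: (submod_chain_extend (sI _ jn) _ Np).
  exact: submod_chainS Pq.
exists p, q.+1; split; first by rewrite addnS ltnS.
  exact: submod_chainS Np.
apply: (submod_chain_extend (sD _ jn) _ Pq); split=> // HD; apply: njc => z cz.
have [a [b [ca Pb Ez]]] : sum_set (c j) P z.
  by apply: HD; apply: (sub_sum_setl sP).
rewrite Ez; apply: (submoduleD sj) => //.
suff: (c j.+1 `&` P) b by case/H.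
split=> //; have -> : b = z - a by rewrite Ez addrC addKr.
by apply: (submoduleB sj1) => //; apply: cj.
Qed.

Lemma has_length_chain N L l n :
  has_length N L l -> submod_chain N L n -> (n <= l)%N.
Proof.
move=> [_ nl] Hn; rewrite leqNgt; apply/negP => ln.
exact/nl/(submod_chain_le ln).
Qed.

(** A sequence that never became stationary would contain chains of every length. *)
Lemma has_length_dcc N L l (F : nat -> set M) : has_length N L l ->
  (forall n, [/\ submodule (F n), N `<=` F n & F n `<=` L]) ->
  (forall n, F n.+1 `<=` F n) ->
  exists n0, forall n, (n0 <= n)%N -> F n = F n0.
Proof.
move=> [_ nl] HF FS; apply: contrapT => H; apply: nl.
have F_le i j : (i <= j)%N -> F j `<=` F i.
  move=> /subnK <-; elim: (j - i)%N => [//|q IH].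
  exact: subset_trans (FS _) IH.
suff C q n : submod_chain N (F n) q.
  by apply: submod_chainS (C _ 0%N) => //; case: (HF 0%N).
elim: q n => [|q IH] n; have [sn Nn _] := HF n.
  exact: (@submod_chain0 _ _ (F n)).
have [n' [nn' nE]] : exists n', (n <= n')%N /\ F n' <> F n.
  apply: contrapT => H'; apply: H; exists n => n' nn'.
  by apply: contrapT => nE; apply: H'; exists n'.
apply: submod_chain_extend (IH n') => //; rewrite properEneq; split.
  exact/eqP.
exact: F_le.
Qed.

End Lengths.

(** Monotonicity keeps the inclusions of a chain and reflection of inclusions keeps them strict. The
    rings may differ because [initial] goes from submodules over R to submodules over G; images,
    preimages and intersections are the other instances. *)
Lemma submod_chain_map (R R' : comNzRingType) (M : lmodType R) (M' :
  lmodType R')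
    (f : set M -> set M') N L N' L' n :
  (forall A, submodule A -> N `<=` A -> A `<=` L ->
     [/\ submodule (f A), N' `<=` f A & f A `<=` L']) ->
  (forall A B, submodule A -> submodule B -> N `<=` A -> A `<=` L ->
     N `<=` B -> B `<=` L -> A `<=` B -> f A `<=` f B) ->
  (forall A B, submodule A -> submodule B -> N `<=` A -> B `<=` L ->
     A `<=` B -> f B `<=` f A -> B `<=` A) ->
  submod_chain N L n -> submod_chain N' L' n.
Proof.
move=> Hf fS finj [c [Hc Sc]]; exists (f \o c); split=> i lin /=.
  by have [? ? ?] := Hc i lin; apply: Hf.
have [? ? ?] := Hc i (ltnW lin); have [? ? ?] := Hc i.+1 lin.
have [cS ncS] := Sc i lin; split; first exact: fS.
by move=> H; apply: ncS; apply: finj.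
Qed.

Section Quotients.
Variables (R : comNzRingType) (M : lmodType R) (L : set M).

Let coset_repr (z : M) : M := xget 0 [set w | span L (z - w)].

Let coset_reprP z : span L (z - coset_repr z).
Proof.
rewrite /coset_repr; apply: (xgetPex 0 (P := [set w | span L (z - w)])).
by exists z; rewrite /= subrr; apply: (submodule0 (submodule_span L)).
Qed.

Let coset_repr_eq z w : span L (z - w) -> coset_repr z = coset_repr w.
Proof.
have sL := submodule_span L; move=> Lzw; congr (xget 0 _).
apply/seteqP; split=> u /= Lu.
  by rewrite -(subrKA z) -opprB; apply: (submoduleD sL) => //;
    apply: (submoduleN sL).
by rewrite -(subrKA w); apply: (submoduleD sL).
Qed.

(* The quotient by span L, realised on canonical coset representatives; taking
   the span makes it total in L, so that no proof of submodule L is carried. *)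
Definition quotm : Type := {z : M | coset_repr z == z}.

HB.instance Definition _ := Choice.on quotm.

Let cls_subproof z : coset_repr (coset_repr z) == coset_repr z.
Proof.
apply/eqP/coset_repr_eq; rewrite -opprB.
exact: (submoduleN (submodule_span L)).
Qed.

Definition quotm_class (z : M) : quotm := exist _ (coset_repr z)
  (cls_subproof z).

Lemma quotm_class_eq z w : span L (z - w) -> quotm_class z = quotm_class w.
Proof. by move=> H; apply: val_inj; apply: coset_repr_eq. Qed.

Lemma quotm_class_inj z w : quotm_class z = quotm_class w -> span L (z - w).
Proof.
move=> /(congr1 val) /= E; rewrite -(subrKA (coset_repr z)) {2}E -[_ - w]opprB.
have sL := submodule_span L.
by apply: (submoduleD sL) => //; apply: (submoduleN sL).
Qed.

Lemma quotm_classK (x : quotm) : quotm_class (val x) = x.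
Proof. by apply: val_inj => /=; apply/eqP/(valP x). Qed.

Let qadd (x y : quotm) := quotm_class (val x + val y).
Let qopp (x : quotm) := quotm_class (- val x).
Let qscale (r : R) (x : quotm) := quotm_class (r *: val x).

Let class_val z : span L (val (quotm_class z) - z).
Proof. by apply: quotm_class_inj; rewrite quotm_classK. Qed.

Let qaddE z w : qadd (quotm_class z) (quotm_class w) = quotm_class (z + w).
Proof.
apply: quotm_class_eq; rewrite opprD addrACA.
exact: (submoduleD (submodule_span L)).
Qed.

Let qoppE z : qopp (quotm_class z) = quotm_class (- z).
Proof.
apply: quotm_class_eq; rewrite -opprD.
exact: (submoduleN (submodule_span L)).
Qed.

Let qscaleE r z : qscale r (quotm_class z) = quotm_class (r *: z).
Proof.
apply: quotm_class_eq; rewrite -scalerBr.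
exact: (submoduleZ _ (submodule_span L)).
Qed.

Let qind (P : quotm -> Prop) : (forall z, P (quotm_class z)) -> forall x, P x.
Proof. by move=> H x; rewrite -(quotm_classK x). Qed.

Let qaddA : associative qadd.
Proof. by do 3!elim/qind=> ?; rewrite !qaddE addrA. Qed.
Let qaddC : commutative qadd.
Proof. by do 2!elim/qind=> ?; rewrite !qaddE addrC. Qed.
Let qadd0 : left_id (quotm_class 0) qadd.
Proof. by elim/qind=> ?; rewrite !qaddE add0r. Qed.
Let qaddN : left_inverse (quotm_class 0) qopp qadd.
Proof. by elim/qind=> ?; rewrite qoppE qaddE addNr. Qed.

HB.instance Definition _ := GRing.isZmodule.Build quotm qaddA qaddC qadd0 qaddN.

Let qclassD z w : quotm_class z + quotm_class w = quotm_class (z + w).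
Proof. exact: qaddE. Qed.
Let qscaleA a b v : qscale a (qscale b v) = qscale (a * b) v.
Proof. by elim/qind: v => z; rewrite !qscaleE scalerA. Qed.
Let qscale1 : left_id 1 qscale.
Proof. by elim/qind=> z; rewrite qscaleE scale1r. Qed.
Let qscaleDr : right_distributive qscale +%R.
Proof. by move=> a; do 2!elim/qind=> ?; rewrite !(qclassD, qscaleE)
  scalerDr. Qed.
Let qscaleDl v : {morph qscale^~ v : a b / a + b}.
Proof. by elim/qind: v => z a b; rewrite !qscaleE qclassD scalerDl. Qed.

HB.instance Definition _ :=
  GRing.Zmodule_isLmodule.Build R quotm qscaleA qscale1 qscaleDr qscaleDl.

Let quotm_class_linear : linear quotm_class.
Proof. by move=> a u v; rewrite -[RHS]/(qadd (qscale a _) _) qscaleE qaddE. Qed.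

HB.instance Definition _ :=
  GRing.isLinear.Build R M quotm _ quotm_class quotm_class_linear.

Lemma quotm_classP : submodule L -> quotient_map L quotm_class.
Proof.
move=> sL; have LL : span L = L.
  by apply/seteqP; split; [apply: span_min | apply: sub_span].
split; apply/seteqP; split=> // z.
- by move=> _; exists (val z) => //; apply: quotm_classK.
- move=> /= z0; rewrite -LL -[z]subr0; apply: quotm_class_inj.
  by rewrite z0 linear0.
- move=> Lz; rewrite /= -(linear0 quotm_class); apply: quotm_class_eq.
  by rewrite subr0; apply: sub_span.
Qed.

End Quotients.

Section QuotientMaps.
Variables (R : comNzRingType) (M A : lmodType R) (K : set M).
Variables (f : {linear M -> A}) (fK : quotient_map K f).
Implicit Types (L : set M) (x : R).

Lemma quotient_map_surj (a : A) : exists z, f z = a.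
Proof. by have: [set: A] a by []; rewrite -fK.1 => -[z _ <-]; exists z. Qed.

Lemma quotient_map_ker z : f z = 0 <-> K z.
Proof. by rewrite -fK.2. Qed.

Lemma image_submodule L : submodule L -> submodule (f @` L).
Proof.
move=> sL; split; first by exists 0; [apply: (submodule0 sL) | rewrite linear0].
move=> r _ _ [u Lu <-] [v Lv <-]; exists (r *: u + v); last by rewrite linearP.
by apply: (submoduleD sL) => //; apply: (submoduleZ _ sL).
Qed.

Lemma preimage_submodule (B : set A) : submodule B -> submodule (f @^-1` B).
Proof.
move=> sB; split; first by rewrite /preimage /= linear0; apply: (submodule0 sB).
by move=> r u v Bu Bv; rewrite /preimage /= linearP; case: sB => _; apply.
Qed.

Lemma image_quotient_map L z : submodule L -> K `<=` L -> (f @` L) (f z) -> L z.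
Proof.
move=> sL KL [y Ly E]; rewrite -(subrK y z); apply: (submoduleD sL) => //.
by apply/KL/quotient_map_ker; rewrite linearB /= E subrr.
Qed.

Lemma has_length_quotient L l : submodule L -> K `<=` L ->
  has_length [set 0] (f @` L) l -> has_length K L l.
Proof.
move=> sL KL [ch nch]; split.
  apply: (@submod_chain_map _ _ _ _ (fun B => f @^-1` B) _ _ _ _ _ _ _ _ ch) =>
    [B sB _ BL|B C _ _ _ _ _ _|B C sB sC _ _ _ H].
  - split; first exact: preimage_submodule.
      by move=> z /quotient_map_ker fz; rewrite /preimage /= fz;
        apply: (submodule0 sB).
    by move=> z /BL; apply: image_quotient_map.
  - by move=> BC z /BC.
  - by move=> a; have [z <-] := quotient_map_surj a; apply: H.
move=> ch'; apply: nch; apply: (@submod_chain_map _ _ _ _ (fun B => f @` B)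
  _ _ _ _ _ _ _ _ ch') => [B sB KB BL|B C _ _ _ _ _ _|B C sB sC KB _ _ H].
- split; first exact: image_submodule.
    by move=> _ ->; exists 0; [apply: (submodule0 sB) | rewrite linear0].
  exact: image_subset.
- exact: image_subset.
- by move=> z Cz; apply: image_quotient_map => //; apply: H; exists z.
Qed.

Lemma torsion_quotient m : @torsion R m A = f @` sat m K.
Proof.
apply/seteqP; split=> [a|_ [z [t Ht] <-]]; last first.
  by exists t => r /Ht /quotient_map_ker; rewrite linearZ.
have [z <-] := quotient_map_surj a; move=> [t Ht]; exists z => //.
by exists t => r /Ht; rewrite -linearZ => /quotient_map_ker.
Qed.

Lemma regular_quotient x z : regular A x -> K (x *: z) -> K z.
Proof.
by move=> rx /quotient_map_ker; rewrite linearZ => /rx /quotient_map_ker.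
Qed.

Lemma scale_quotient x : scale_set A x = f @` sum_set K (scale_set M x).
Proof.
apply/seteqP; split=> [_ [a _ <-]|_ [_ [u [_ [/quotient_map_ker Ku [z _ <-]
  ->]]] <-]].
  have [z <-] := quotient_map_surj a; exists (x *: z); last by rewrite linearZ.
  by exists 0, (x *: z); split;
    [rewrite -quotient_map_ker linear0 | exists z | rewrite add0r].
by exists (f z) => //; rewrite linearD /= Ku add0r linearZ.
Qed.

Lemma fin_gen_quotient : fin_gen [set: M] -> fin_gen [set: A].
Proof.
move=> [s Hs]; exists (map f s); apply/seteqP; split=> // a _.
have [z <-] := quotient_map_surj a.
have sS := @submodule_span R A [set y | y \in map f s].
suff: span [set y | y \in s] `<=` f @^-1` span [set y | y \in map f s].
  by apply; rewrite -Hs.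
apply: span_min; first exact: preimage_submodule.
by move=> y ys; apply: sub_span; apply: map_f.
Qed.

End QuotientMaps.

(** The value of h on classes is part of the conclusion because the graded case reads off from it
    that h respects degrees. *)
Lemma quotm_factor (R : comNzRingType) (M : lmodType R) (K K' : set M) :
  submodule K -> submodule K' -> K `<=` K' ->
  exists2 h : {linear quotm K -> quotm K'},
    quotient_map (quotm_class K @` K') h
    & forall z, h (quotm_class K z) = quotm_class K' z.
Proof.
move=> sK sK' KK'; pose h (x : quotm K) := quotm_class K' (val x).
have hE z : h (quotm_class K z) = quotm_class K' z.
  apply: quotm_class_eq; apply: sub_span; apply: KK'.
  apply/(quotient_map_ker (quotm_classP sK)); rewrite linearB.
  by apply/eqP; rewrite subr_eq0; apply/eqP; apply: quotm_classK.
have h_lin : linear h.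
  move=> r x y; rewrite -(quotm_classK x) -(quotm_classK y) -linearP !hE.
  by rewrite linearP.
pose hM := GRing.isLinear.Build R _ _ _ h h_lin.
pose hL : {linear quotm K -> quotm K'} := HB.pack h hM.
exists hL => //; have qK := quotm_classP sK; have qK' := quotm_classP sK'.
split; apply/seteqP; split=> // x.
- move=> _; have [z <-] := quotient_map_surj qK' x.
  by exists (quotm_class K z); rewrite //= hE.
- have [z <-] := quotient_map_surj qK x; rewrite /= hE.
  by move/(quotient_map_ker qK'); exists z.
- by move=> [z Kz <-] /=; rewrite hE; apply/(quotient_map_ker qK').
Qed.

(** * Degrees of the quotients of a module *)

Section SubmoduleDegree.
Variables (R : comNzRingType) (m : set R) (M : lmodType R).

(* The cohomological degree K |-> beta K = bdeg (M / K) on the submodules adm of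
   M for which M / K lies in the category; V K is the genericity set U (M / K). *)
Record submodule_degree (adm : set M -> Prop) (V : set M -> set R)
    (beta : set M -> nat) : Prop := SubmoduleDegree {
  adm_submodule : forall K, adm K -> submodule K;
  adm_sat : forall K, adm K -> adm (sat m K);
  degree_sat : forall K, adm K ->
    exists2 l, has_length K (sat m K) l & beta K = (beta (sat m K) + l)%N;
  generic_mod_regular : forall K x z, adm K -> sat m K `<=` K -> V K x ->
    K (x *: z) -> K z;
  adm_generic : forall K x, adm K -> V K x -> adm (sum_set K (scale_set M x));
  degree_generic : forall K x, adm K -> sat m K `<=` K -> V K x ->
    beta K = beta (sum_set K (scale_set M x));
  degree_setT : beta setT = 0%N
}.

(** The second clause of [has_multiplicity] cannot hold here: the annihilator contains 1, so no
    prime ideal contains it. *)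
Lemma has_multiplicity_zero (A : lmodType R) e :
  zero_module A -> has_multiplicity m A e -> e = 0%N.
Proof.
move=> A0 [[_ ->]//|[d [P [[[c [Hc _]] _] _ _]]]].
have [[_ nc _] annc] := Hc 0%N (leq0n d).
by case: nc; apply: annc => z; rewrite scale1r; apply: A0.
Qed.

Variables (Ob : Type) (um : Ob -> lmodType R) (C : Ob -> Prop).
Variable quot : forall A B : Ob, set (um A) -> Prop.
Variables (U : Ob -> set R) (b : Ob -> nat).
Variables (adm : set M -> Prop) (Q : set M -> Ob).
Variable f : forall K, {linear M -> um (Q K)}.

(** Shared by the local and the graded case: Q K is a model of M / K with projection f K. The
    torsion of M / K is sat K / K, and x (M / K) is (K + x M) / K, so the axioms become statements
    on submodules. A saturated K gives a quotient without torsion, hence of depth at least 1. *)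
Lemma submodule_degree_of_bdeg :
  noetherian R -> ideal m ->
  (forall A, C A -> fin_gen [set: um A]) ->
  bdeg_axioms m C quot U b -> generic_regular m um C U ->
  (forall K, adm K -> submodule K) -> adm setT ->
  (forall K, adm K -> adm (sat m K)) ->
  (forall K x, adm K -> U (Q K) x -> adm (sum_set K (scale_set M x))) ->
  (forall K, adm K -> C (Q K)) ->
  (forall K, adm K -> quotient_map K (f K)) ->
  (forall K K', adm K -> adm K' -> K `<=` K' -> @quot (Q K) (Q K') (f K @` K'))
    ->
  submodule_degree adm (U \o Q) (b \o Q).
Proof.
move=> nR sm Cfg [_ bCM btors bgen] greg sadm admT admS admG CQ fQ qQ.
have depthQ K : adm K -> sat m K `<=` K -> depth_ge m (um (Q K)) 1.
  move=> aK satK; apply: depth_ge1_torsion => //.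
    by apply: noetherian_fin_gen => //; apply: Cfg; apply: CQ.
  rewrite (torsion_quotient (fQ K aK)) => _ [z /satK Kz <-].
  exact/(quotient_map_ker (fQ K aK)).
split=> //.
- move=> K aK; have sK := sadm K aK; have aS := admS K aK.
  have KS : K `<=` sat m K by apply: sub_sat.
  have := btors (Q K) (Q (sat m K)) (CQ K aK).
  rewrite (torsion_quotient (fQ K aK)) => /(_ (qQ _ _ aK aS KS)) [l Hl bE].
  exists l => //; apply: (has_length_quotient (fQ K aK)) => //.
  exact: sadm.
- move=> K x z aK satK Ux; apply: (regular_quotient (fQ K aK)).
  by apply: greg Ux; [apply: CQ | apply: depthQ].
- move=> K x aK satK Ux; apply: (bgen _ _ x) => //;
    [exact: CQ | exact: depthQ |].
  rewrite -/(scale_set _ x) (scale_quotient (fQ K aK)); apply: qQ => //.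
    exact: admG.
  by apply: sub_sum_setl; apply: submodule_scale_set.
have QT0 : zero_module (um (Q setT)).
  move=> a; have [z <-] := quotient_map_surj (fQ _ admT) a.
  exact/(quotient_map_ker (fQ _ admT)).
apply: (has_multiplicity_zero QT0); apply: bCM (CQ _ admT) _.
by left.
Qed.

End SubmoduleDegree.

(** * Graded modules *)

Section GradingProjections.
Variables (I : eqType) (V : zmodType) (A : I -> set V).
Implicit Types (i j : I) (x y : V) (s : seq I) (c : I -> V).

Let component_of i x y := exists s c,
  [/\ uniq s, forall j, A j (c j), forall j, j \notin s -> c j = 0,
      x = \sum_(j <- s) c j & y = c i].

(** The homogeneous component of x in degree i. A grading provides decompositions only by existence
    and uniqueness, so the component is chosen; the default 0 is never reached once A is a
    grading. *)
Definition gproj i x : V := xget 0 (component_of i x).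

Hypothesis gA : grading A.

Lemma grading0 i : A i 0.
Proof. by case: gA => /(_ i)[]. Qed.

Lemma gradingB i x y : A i x -> A i y -> A i (x - y).
Proof. by case: gA => /(_ i)[_ AB] _ _; apply: AB. Qed.

Lemma gradingN i x : A i x -> A i (- x).
Proof. by move=> ?; rewrite -sub0r; apply: gradingB => //; apply: grading0. Qed.

Lemma gradingD i x y : A i x -> A i y -> A i (x + y).
Proof. by move=> ? ?; rewrite -[y]opprK; apply: gradingB => //;
  apply: gradingN. Qed.

Lemma gradingMn i x n : A i x -> A i (x *+ n).
Proof.
move=> Ax; elim: n => [|n IH]; first exact: grading0.
by rewrite mulrS; apply: gradingD.
Qed.

Let sumE s u c : uniq s -> uniq u -> (forall j, j \notin s -> c j = 0) ->
  {subset s <= u} -> \sum_(j <- s) c j = \sum_(j <- u) c j.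
Proof.
move=> us uu c0 su; rewrite [RHS](bigID (fun j => j \in s))
  /= [X in _ + X]big1 ?addr0.
  rewrite -[RHS]big_filter; apply: perm_big; apply: uniq_perm => //.
    by rewrite filter_uniq.
  move=> j; rewrite mem_filter; case: (boolP (j \in s)) => //= js.
  by rewrite su.
by move=> j /c0.
Qed.

Lemma gproj_def s c i : uniq s -> (forall j, A j (c j)) ->
  (forall j, j \notin s -> c j = 0) -> gproj i (\sum_(j <- s) c j) = c i.
Proof.
move=> us Ac c0; apply: (@xget_unique _ 0 (component_of i _)).
  by exists s, c.
move=> _ [s' [d [us' Ad d0 E ->]]].
have [_ _ uniqA] := gA.
have [iss|] := boolP (i \in undup (s ++ s')); last first.
  by rewrite mem_undup mem_cat negb_or => /andP[/c0 -> /d0 ->].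
apply/eqP; rewrite -subr_eq0; apply/eqP.
apply: (uniqA (undup (s ++ s')) (fun j => d j - c j)) iss.
- exact: undup_uniq.
- by move=> j; apply: gradingB.
rewrite sumrB -(sumE (s := s') (c := d)) -?(sumE (s := s) (c := c))
  ?undup_uniq ?E ?subrr //.
  by move=> j js; rewrite mem_undup mem_cat js.
by move=> j js; rewrite mem_undup mem_cat js orbT.
Qed.

Lemma graded_decomposition x : exists s c, [/\ uniq s, forall j, A j (c j),
  forall j, j \notin s -> c j = 0 & x = \sum_(j <- s) c j].
Proof.
have [_ /(_ x)[s [c [Ac ->]]] _] := gA.
(* The given sequence may repeat indices; removing repetitions multiplies a component by the
   multiplicity of its index. *)
exists (undup s), (fun j => if j \in s then c j *+ count_mem j s else 0); split.
- exact: undup_uniq.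
- by move=> j; case: ifP => _; [apply: gradingMn | apply: grading0].
- by move=> j; rewrite mem_undup => /negbTE ->.
rewrite -big_undup_iterop_count; apply: eq_big_seq => j.
by rewrite mem_undup => ->; rewrite Monoid.iteropE iter_addr addr0.
Qed.

Lemma gproj_in i x : A i (gproj i x).
Proof.
have [s [c [us Ac c0 ->]]] := graded_decomposition x.
by rewrite gproj_def.
Qed.

Lemma gproj_decomp x : exists s, [/\ uniq s,
  forall j, j \notin s -> gproj j x = 0 & x = \sum_(j <- s) gproj j x].
Proof.
have [s [c [us Ac c0 ->]]] := graded_decomposition x.
exists s; split=> // [j js|]; first by rewrite gproj_def // c0.
by apply: eq_bigr => j _; rewrite gproj_def.
Qed.

Lemma gproj_id i x : A i x -> gproj i x = x.
Proof.
move=> Ax; rewrite -{1}[x](big_seq1 +%R i (fun=> x)).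
pose c j := if j == i then x else 0.
rewrite (_ : \sum_(j <- [:: i]) x = \sum_(j <- [:: i]) c j).
  rewrite gproj_def // /c ?eqxx // => j; first by case: eqP => [->|_] //;
    apply: grading0.
  by rewrite mem_seq1 => /negbTE ->.
by rewrite !big_seq1 /c eqxx.
Qed.

Lemma gproj_neq i j x : A i x -> j != i -> gproj j x = 0.
Proof.
move=> Ax ji; rewrite -[x](big_seq1 +%R i (fun=> x)).
pose c j := if j == i then x else 0.
rewrite (_ : \sum_(j <- [:: i]) x = \sum_(j <- [:: i]) c j).
  rewrite gproj_def // /c ?(negbTE ji) // => l.
    by case: eqP => [->|_] //; apply: grading0.
  by rewrite mem_seq1 => /negbTE ->.
by rewrite !big_seq1 /c eqxx.
Qed.

Lemma gprojB i x y : gproj i (x - y) = gproj i x - gproj i y.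
Proof.
have [s [us x0 Ex]] := gproj_decomp x; have [s' [us' y0 Ey]] := gproj_decomp y.
pose u := undup (s ++ s').
have widen z t : uniq t -> (forall j, j \notin t -> gproj j z = 0) ->
    {subset t <= u} -> \sum_(j <- t) gproj j z = \sum_(j <- u) gproj j z.
  by move=> ut; apply: sumE; rewrite ?undup_uniq.
rewrite {1}Ex {1}Ey (widen x s) ?(widen y s') // -?sumrB ?gproj_def //.
- exact: undup_uniq.
- by move=> j; apply: gradingB; apply: gproj_in.
- move=> j; rewrite mem_undup mem_cat negb_or => /andP[/x0 -> /y0 ->].
  by rewrite subrr.
- by move=> j js; rewrite mem_undup mem_cat js orbT.
- by move=> j js; rewrite mem_undup mem_cat js.
Qed.

Lemma gproj0 i : gproj i 0 = 0.
Proof. exact/gproj_id/grading0. Qed.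

Lemma gprojD i x y : gproj i (x + y) = gproj i x + gproj i y.
Proof.
by rewrite -{1}[y]opprK gprojB -[- y]sub0r gprojB gproj0 sub0r opprK.
Qed.

Lemma gproj_sum i (T : Type) (r : seq T) (P : pred T) (F : T -> V) :
  gproj i (\sum_(t <- r | P t) F t) = \sum_(t <- r | P t) gproj i (F t).
Proof. exact: (big_morph _ (gprojD i) (gproj0 i)). Qed.

Lemma gproj_eq0 x : (forall i, gproj i x = 0) -> x = 0.
Proof.
by move=> x0; have [s [_ _ ->]] := gproj_decomp x; rewrite big1 // => i _;
  rewrite x0.
Qed.

End GradingProjections.

(** What is common to homogeneous algebras and to gr_m(R); [std_pow] is the form in which generation
    in degree 1 is used. *)
Record standard_grading (R : comNzRingType) (Rg : nat -> set R) : Prop :=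
  StandardGrading {
    std_grading : grading Rg;
    std_mul : forall i j a b, Rg i a -> Rg j b -> Rg (i + j)%N (a * b);
    std_pow : forall i, Rg i `<=` pow_ideal (irrelevant Rg) i
  }.

(* The degrees of M range over J; scaling by degree i shifts them by sh i.  This
   covers both Z-graded modules and the N-graded ring acting on itself. *)
Section GradedScaling.
Variables (R : comNzRingType) (Rg : nat -> set R) (gR : grading Rg).
Variables (M : lmodType R) (J : eqType) (A : J -> set M) (gA : grading A).
Variables (sh : nat -> J -> J) (deg : J -> int).
Hypothesis sh_inj : forall i, injective (sh i).
Hypothesis deg_sh : forall i j, deg (sh i j) = i%:Z + deg j.
Hypothesis scaleA : forall i j a z, Rg i a -> A j z -> A (sh i j) (a *: z).
Implicit Types (K L : set M).

Definition homogeneous_set K : Prop := forall j z, K z -> K (gproj A j z).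

Lemma homogeneous_submodule L : L 0 -> (forall u v, L u -> L v -> L (u + v)) ->
  (forall i a z, Rg i a -> L z -> L (a *: z)) -> submodule L.
Proof.
move=> L0 LD LZ; split=> // a u v Lu Lv; apply: (LD) => //.
have [s [_ _ ->]] := gproj_decomp gR a; rewrite scaler_suml.
apply: (big_ind L) => [//|u1 u2|i _]; first exact: LD.
by apply: (LZ i) => //; apply: gproj_in.
Qed.

Lemma gproj_scale i j a z : Rg i a -> gproj A (sh i j) (a *: z) = a *:
  gproj A j z.
Proof.
move=> Ra; have [s [us z0 Ez]] := gproj_decomp gA z.
rewrite [in LHS]Ez scaler_sumr (gproj_sum gA).
have gE l : gproj A (sh i j) (a *: gproj A l z) =
    if l == j then a *: gproj A j z else 0.
  have Al : A (sh i l) (a *: gproj A l z) by apply: scaleA => //;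
    apply: gproj_in.
  case: eqP => [<-|lj]; first by rewrite gproj_id.
  by apply: (gproj_neq gA Al); apply/eqP => /sh_inj /esym.
rewrite (eq_bigr _ (fun l _ => gE l)).
have [js|js] := boolP (j \in s); last first.
  rewrite z0 // scaler0 big1 // => l _; case: ifP => // _; exact: scaler0.
by rewrite -big_mkcond -big_filter filter_pred1_uniq // big_seq1.
Qed.

Lemma gproj_scale_out i l a z : Rg i a -> (forall j, l <> sh i j) ->
  gproj A l (a *: z) = 0.
Proof.
move=> Ra lout; have [s [us z0 Ez]] := gproj_decomp gA z.
rewrite Ez scaler_sumr (gproj_sum gA) big1 // => j _.
apply: (@gproj_neq _ _ _ gA (sh i j)); last exact/eqP/lout.
by apply: scaleA => //; apply: gproj_in.
Qed.

Lemma homogeneous_scale K i a j z : submodule K -> Rg i a ->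
  (forall l, K (a *: gproj A l z)) -> K (gproj A j (a *: z)).
Proof.
move=> sK Ra H; have [[l ->]|H'] := pselect (exists l, j = sh i l).
  by rewrite gproj_scale.
rewrite (gproj_scale_out _ Ra) => [|l E]; first exact: submodule0.
by apply: H'; exists l.
Qed.

Lemma homogeneous_sum_set K L : homogeneous_set K -> homogeneous_set L ->
  homogeneous_set (sum_set K L).
Proof.
move=> hK hL j _ [u [v [Ku Lv ->]]].
by exists (gproj A j u), (gproj A j v); rewrite (gprojD gA); split;
  [apply: hK | apply: hL |].
Qed.

Lemma homogeneous_scale_set i a : Rg i a -> homogeneous_set (scale_set M a).
Proof.
move=> Ra j _ [z _ <-]; apply: (homogeneous_scale _ _ Ra).
  exact: submodule_scale_set.
by move=> l; exists (gproj A l z).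
Qed.

Lemma homogeneous_smul (I : set R) L : (forall i a, I a -> I (gproj Rg i a)) ->
  homogeneous_set L -> homogeneous_set (smul I L).
Proof.
move=> hI hL j z Lz; have sIL := @submodule_smul R M I L.
pose H := [set y | forall l, smul I L (gproj A l y)].
suff: smul I L `<=` H by move=> /(_ z Lz).
apply: smul_min => [|a y Ia Ly l].
  apply: homogeneous_submodule => [l|u v Hu Hv l|i a y Ra Hy l].
  - by rewrite (gproj0 gA); apply: (submodule0 sIL).
  - by rewrite (gprojD gA); apply: (submoduleD sIL).
  - apply: (homogeneous_scale _ sIL Ra) => l'; exact: (submoduleZ _ sIL).
have [s [_ _ ->]] := gproj_decomp gR a.
rewrite scaler_suml (gproj_sum gA); apply: (submodule_sum sIL) => i _.
apply: (homogeneous_scale _ sIL (gproj_in gR i a)) => l'.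
by apply: mem_smul; [apply: hI | apply: hL].
Qed.

Lemma submodule_degree_ge n :
  submodule [set z | forall j, deg j < n -> gproj A j z = 0].
Proof.
apply: homogeneous_submodule => [j _|u v Hu Hv j jn|i a z Ra Hz j jn].
- exact: gproj0.
- by rewrite (gprojD gA) Hu // Hv // addr0.
have [[l E]|H] := pselect (exists l, j = sh i l).
  rewrite E gproj_scale // Hz ?scaler0 //.
  by apply: le_lt_trans jn; rewrite E deg_sh lerDr.
by rewrite (gproj_scale_out _ Ra) // => l E; apply: H; exists l.
Qed.

(** Each factor from the irrelevant ideal has only components of degree at least 1, so it raises the
    lowest degree by at least 1. *)
Lemma pow_irrelevant_degree_ge n z :
  (forall j y, deg j < 0 -> gproj A j y = 0) ->
  (pow_mod (irrelevant Rg) n : set M) z ->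
  forall j, deg j < n%:Z -> gproj A j z = 0.
Proof.
move=> A_ge0; elim: n z => [|n IH] z; first by move=> _ j; apply: A_ge0.
have sD := submodule_degree_ge n.+1%:Z.
suff: smul (irrelevant Rg) (pow_mod (irrelevant Rg) n) `<=`
    [set z | forall j, deg j < n.+1%:Z -> gproj A j z = 0] by apply.
apply: smul_min => // _ y [p [c [Rc ->]]] /IH Hy.
rewrite scaler_suml big_nat_cond; apply: (submodule_sum sD) =>
  i /andP[/andP[i1 _] _] j jn.
have [[l E]|H] := pselect (exists l, j = sh i l).
  rewrite E gproj_scale // Hy ?scaler0 //.
  move: jn; rewrite E deg_sh -[n.+1]add1n PoszD => jn.
  rewrite -(ltrD2l 1); apply: le_lt_trans jn; rewrite lerD2r.
  by rewrite lez_nat.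
by rewrite (gproj_scale_out _ (Rc i)) // => l E; apply: H; exists l.
Qed.

End GradedScaling.

Section StandardGraded.
Variables (R : comNzRingType) (Rg : nat -> set R) (sR : standard_grading Rg).
Let gR := std_grading sR.
Notation m := (irrelevant Rg).

Let scaleR i j (a : R) (b : R^o) : Rg i a -> Rg j b -> Rg (i + j)%N (a *: b).
Proof. exact: std_mul. Qed.

Let gRo : @grading nat R^o Rg := gR.

Lemma irrelevantP a : m a <-> gproj Rg 0%N a = 0.
Proof.
split=> [[n [c [Rc ->]]]|a0].
  rewrite (gproj_sum gR) big_nat_cond big1 // => i /andP[/andP[i1 _] _].
  by apply: (gproj_neq gR (Rc i)); rewrite eq_sym -lt0n.
have [s [us a0s E]] := gproj_decomp gR a.
pose n := (\max_(i <- s) i).+1.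
pose c i := if i \in index_iota 1 n then gproj Rg i a else 0.
have Rc i : Rg i (c i).
  by rewrite /c; case: ifP => _; [apply: gproj_in | apply: grading0].
exists n, c; split=> //; apply/eqP; rewrite -subr_eq0; apply/eqP.
apply: (gproj_eq0 gR) => i; rewrite (gprojB gR) (gproj_def gR) ?iota_uniq //.
  rewrite /c mem_index_iota; case: ifP => [_|/negbT]; first exact: subrr.
  rewrite negb_and subr0 -leqNgt leqn0 => /orP[/eqP -> //|].
  rewrite -leqNgt => ni; apply: a0s; apply/negP => si.
  by move: ni; rewrite leqNgt ltnS (leq_bigmax_seq i).
by move=> l; rewrite /c => /negbTE ->.
Qed.

Lemma irrelevant_ideal : ideal m.
Proof.
have -> : m = [set a | forall j : nat, j%:Z < 1 -> @gproj nat R^o Rg j a = 0].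
  apply/seteqP; split=> [a /irrelevantP a0 [|//] _ //|a H].
  exact/irrelevantP/(H 0%N).
apply: (@submodule_degree_ge R Rg gR R^o nat Rg gRo addn Posz) => //.
exact: addnI.
Qed.

Lemma pow_irrelevant_gproj n a i : pow_ideal m n a -> (i < n)%N ->
  gproj Rg i a = 0.
Proof.
move=> ma lin; apply: (@pow_irrelevant_degree_ge R Rg gR R^o nat Rg gRo addn
  Posz) ma _ lin => //.
exact: addnI.
Qed.

Lemma Rg_pow_irrelevant i n : (n <= i)%N -> Rg i `<=` pow_ideal m n.
Proof.
by move=> ni a /(std_pow sR); apply: (@pow_mod_sub R R^o).
Qed.

(** Elements of m^n have no component below degree n, so homogeneous elements suffice to test an
    inclusion of m^n. *)
Lemma pow_irrelevant_min n (Z : set R) : ideal Z ->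
  (forall i, (n <= i)%N -> Rg i `<=` Z) -> pow_ideal m n `<=` Z.
Proof.
move=> sZ HZ a ma; have [s [_ _ ->]] := gproj_decomp gR a.
apply: (@submodule_sum R R^o Z _ _ _ _ sZ) => i _.
have [ni|lin] := leqP n i; first by apply: (HZ i ni); apply: gproj_in.
by rewrite (pow_irrelevant_gproj ma lin); apply: (submodule0 sZ).
Qed.

Section GradedModules.
Variables (M : gmodType R) (gM : graded_module Rg M).
Implicit Types (K L : set M).
Notation A := (@gpart R M).

Definition homogeneous_submod K := submodule K /\ homogeneous_set A K.

Let sh (i : nat) (j : int) : int := i%:Z + j.

Let sh_inj i : injective (sh i).
Proof. exact: addrI. Qed.

Let gA : grading A.
Proof. by case: gM. Qed.

Let scaleM i j a z : Rg i a -> A j z -> A (sh i j) (a *: z).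
Proof. by case: gM => _; apply. Qed.

Lemma gpart_scale i j a z : Rg i a -> gproj A (i%:Z + j) (a *: z) = a *:
  gproj A j z.
Proof. exact: (gproj_scale gA sh_inj scaleM). Qed.

Lemma homogeneous_sat K : homogeneous_submod K -> homogeneous_submod (sat m K).
Proof.
move=> [sK hK]; split; first exact: submodule_sat.
move=> j z [t Ht]; exists t => a ma.
suff: pow_ideal m t `<=` transporter (gproj A j z) K by apply.
apply: pow_irrelevant_min => [|i ti b Rb]; first exact: ideal_transporter.
rewrite /transporter /= -(gpart_scale _ _ Rb); apply: hK; apply: Ht.
exact: (Rg_pow_irrelevant ti).
Qed.

Lemma homogeneous_submod_set0 : homogeneous_submod [set 0].
Proof. by split=> [|j _ ->]; [apply:
  submodule_set0 | rewrite /= (gproj0 gA)]. Qed.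

Lemma homogeneous_submod_scale K i a : Rg i a -> homogeneous_submod K ->
  homogeneous_submod (sum_set K (scale_set M a)).
Proof.
move=> Ra [sK hK]; split.
  by apply: submodule_sum_set => //; apply: submodule_scale_set.
apply: homogeneous_sum_set => //.
exact: (homogeneous_scale_set gA sh_inj scaleM Ra).
Qed.

Lemma homogeneous_pow_mod n : homogeneous_set A (pow_mod m n).
Proof.
elim: n => [//|n IH].
apply: (homogeneous_smul gR gA sh_inj scaleM _ IH) => i a.
rewrite !irrelevantP; case: i => [->|i _]; first exact: (gproj0 gR).
by apply: (gproj_neq gR (gproj_in gR i.+1 a)).
Qed.

Lemma homogeneous_submod_pow K n : homogeneous_submod K ->
  homogeneous_submod (sum_set K (pow_mod m n)).
Proof.
move=> [sK hK]; split.
  by apply: submodule_sum_set => //; apply: submodule_pow_mod.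
by apply: homogeneous_sum_set => //; apply: homogeneous_pow_mod.
Qed.

Lemma pow_mod_gproj n z j : (forall i, gpart (Negz i) = [set (0 : M)]) ->
  (pow_mod m n : set M) z -> j < n%:Z -> gproj A j z = 0.
Proof.
move=> A_ge0 mz jn.
apply: (@pow_irrelevant_degree_ge R Rg gR M _ A gA sh id) mz j jn => //.
move=> [//|i] y _; have := gproj_in gA (Negz i) y; rewrite A_ge0; exact.
Qed.

(** Defined for every K; the images of the components form a direct sum once K is a homogeneous
    submodule. *)
Definition quotg (K : set M) : gmodType R :=
  @GMod R (quotm K) (fun j => quotm_class K @` A j).

Lemma quotg_graded K : homogeneous_submod K -> graded_module Rg (quotg K).
Proof.
move=> [sK hK]; split; last first.
  move=> i j a _ Ra [z Az <-]; exists (a *: z); last by rewrite linearZ.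
  exact: scaleM.
have qK := quotm_classP sK; split.
- move=> j; split; first by exists 0; [apply: grading0 | rewrite linear0].
  move=> _ _ [u Au <-] [v Av <-]; exists (u - v); last by rewrite linearB.
  exact: gradingB.
- move=> x; have [z <-] := quotient_map_surj qK x.
  have [s [_ _ Ez]] := gproj_decomp gA z.
  exists s, (fun j => quotm_class K (gproj A j z)).
  split; last by rewrite {1}Ez linear_sum.
  by move=> j; exists (gproj A j z) => //; apply: gproj_in.
move=> s c us Ac sum0 j js.
have /choice[n Hn] i : exists z, A i z /\ quotm_class K z = c i.
  by have [z Az <-] := Ac i; exists z.
have /hK : K (\sum_(i <- s) n i).
  apply/(quotient_map_ker qK); rewrite linear_sum /= -[RHS]sum0.
  by apply: eq_bigr => i _; case: (Hn i).
move=> /(_ j); rewrite (gproj_sum gA) (bigD1_seq j) //=.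
rewrite (gproj_id gA); last by case: (Hn j).
rewrite big1 ?addr0 => [|i ij]; last first.
  by apply: (gproj_neq gA (proj1 (Hn i))); rewrite eq_sym.
by move/(quotient_map_ker qK); case: (Hn j) => _ <-.
Qed.

End GradedModules.

End StandardGraded.

(** * Initial submodules *)

Section InitialSubmodules.
Variables (R G : comNzRingType) (m : set R) (Gg : nat -> set G) (s : nat -> R ->
  G).
Variables (M : lmodType R) (N : gmodType G) (t : nat -> M -> N).
Hypotheses (sm : ideal m) (sG : standard_grading Gg) (gN : graded_module Gg N).
Hypotheses (agR : assoc_graded_ring m Gg s) (agM : assoc_graded_module m s t).
Implicit Types (K L : set M) (x z : M) (y : N) (n : nat).

Notation P n := (pow_mod m n : set M).
Notation A := (@gpart G N).
Notation mG := (irrelevant Gg).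

Let gA : grading A.
Proof. by case: gN. Qed.

Let sP n : submodule (P n).
Proof. exact: submodule_pow_mod. Qed.

Lemma assoc_gradedD n x z : P n x -> P n z -> t n (x + z) = t n x + t n z.
Proof. by case: agM => _ _ /(_ n)[H _ _] _; apply: H. Qed.

Lemma assoc_graded_eq0 n z : P n z -> (t n z = 0 <-> P n.+1 z).
Proof. by case: agM => _ _ /(_ n)[_ _ H] _; apply: H. Qed.

Lemma assoc_graded0 n : t n 0 = 0.
Proof. by apply/assoc_graded_eq0; apply: (submodule0 (sP _)). Qed.

Lemma assoc_gradedB n x z : P n x -> P n z -> t n (x - z) = t n x - t n z.
Proof.
move=> Px Pz; have Pxz : P n (x - z) by apply: (submoduleB (sP _)).
by rewrite -{2}(subrK z x) (assoc_gradedD Pxz Pz) addrK.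
Qed.

Lemma assoc_graded_in n z : P n z -> A n%:Z (t n z).
Proof. by case: agM => _ _ /(_ n)[_ <- _] _ Pz; exists z. Qed.

Lemma assoc_graded_surj n y : A n%:Z y -> exists2 z, P n z & t n z = y.
Proof. by case: agM => _ _ /(_ n)[_ <- _] _ [z Pz <-]; exists z. Qed.

Lemma assoc_graded_scale i j a z : pow_ideal m i a -> P j z ->
  s i a *: t j z = t (i + j)%N (a *: z).
Proof. by case: agM => _ _ _; apply. Qed.

Lemma assoc_graded_ring_surj i (g : G) : Gg i g -> exists2 a,
  pow_ideal m i a & s i a = g.
Proof. by case: agR => _ /(_ i)[_ <- _] _ _ [a ma <-]; exists a. Qed.

Lemma gproj_neg (j : int) y : (j < 0)%R -> gproj A j y = 0.
Proof.
case: j => [//|j] _; have := gproj_in gA (Negz j) y.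
by case: agM => _ -> _ _; exact.
Qed.

(** In degree n this is (K [&] m^n M + m^(n+1) M) / m^(n+1) M. Negative degrees carry no condition
    because the components of N vanish there. *)
Definition initial K : set N :=
  [set y | forall n, (t n @` (K `&` P n)) (gproj A n%:Z y)].

Lemma initialS K L : K `<=` L -> initial K `<=` initial L.
Proof. by move=> KL y Ky n; have [z [/KL Lz Pz] <-] := Ky n; exists z. Qed.

(** The dictionary between the two sides: membership of a form in in K is membership of a lift in K
    up to an error of higher order. *)
Lemma initial_assoc_graded K n z : submodule K -> P n z ->
  (initial K (t n z) <-> sum_set K (P n.+1) z).
Proof.
move=> sK Pz; have An := assoc_graded_in Pz; split=> [/(_ n)|[x [p [Kx Pp Ez]]]
  l].
  rewrite (gproj_id gA An) => -[x [Kx Px] E]; exists x, (z - x); split=> //.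
    apply/(assoc_graded_eq0 (submoduleB (sP _) Pz Px)).
    by rewrite assoc_gradedB // E subrr.
  by rewrite addrC subrK.
have [-> {l}|ln] := eqVneq l n; last first.
  rewrite (gproj_neq gA An) ?eqz_nat //; exists 0; last exact: assoc_graded0.
  by split; [apply: (submodule0 sK) | apply: (submodule0 (sP _))].
have Pp' := pow_modS_sub Pp.
have Ex : x = z - p by rewrite Ez addrK.
have Px : P n x by rewrite Ex; apply: (submoduleB (sP _)).
rewrite (gproj_id gA An); exists x => //.
by rewrite Ez assoc_gradedD // (iffRL (assoc_graded_eq0 Pp')) // addr0.
Qed.

Lemma sub_initial K n z : submodule K -> K z -> P n z -> initial K (t n z).
Proof.
move=> sK Kz Pz; apply/initial_assoc_graded => //.
by apply: sub_sum_setl => //; apply: submodule_pow_mod.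
Qed.

Lemma homogeneous_initial K : submodule K -> homogeneous_submod (initial K).
Proof.
move=> sK.
have K0 n : (t n @` (K `&` P n)) 0.
  exists 0; last exact: assoc_graded0.
  by split; [apply: (submodule0 sK) | apply: (submodule0 (sP _))].
split; last first.
  move=> j y Ky n; have [<-|nj] := eqVneq (n%:Z : int) j.
    by rewrite (gproj_id gA (gproj_in gA _ _)).
  by rewrite (gproj_neq gA (gproj_in gA _ _)).
apply: (homogeneous_submodule (std_grading sG)) =>
  [n|u v Ku Kv n|i g y Gi Ky n].
- by rewrite (gproj0 gA).
- rewrite (gprojD gA); have [x [Kx Px] <-] := Ku n; have [z [Kz Pz] <-] := Kv n.
  exists (x + z); last exact: assoc_gradedD.
  by split; [apply: (submoduleD sK) | apply: (submoduleD (sP _))].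
(* The degree n component of g y comes from degree n - i of y, which is zero when n < i. *)
have -> : n%:Z = i%:Z + (n%:Z - i%:Z) :> int by rewrite addrC subrK.
rewrite (gpart_scale gN) //; have [lin|lni] := leqP i n; last first.
  by rewrite gproj_neg ?scaler0 // subr_lt0 ltz_nat.
rewrite subzn //; have [z [Kz Pz] <-] := Ky (n - i)%N.
have [a ma <-] := assoc_graded_ring_surj Gi.
rewrite assoc_graded_scale // subnKC //; exists (a *: z) => //.
by split; [apply: (submoduleZ _ sK) | rewrite -(subnKC lin);
  apply: pow_mod_scale].
Qed.

Lemma initial_min K (H : set N) : submodule H ->
  (forall n z, K z -> P n z -> H (t n z)) -> initial K `<=` H.
Proof.
move=> sH HK y Ky; have [r [_ _ ->]] := gproj_decomp gA y.
apply: (submodule_sum sH) => -[n|j] _; last by rewrite gproj_neg //;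
  apply: (submodule0 sH).
by have [z [Kz Pz] <-] := Ky n; apply: HK.
Qed.

(** If m^u z lies in K, multiplying the form of z by forms of degree at least u gives forms of
    elements of K. *)
Lemma initial_sat K : submodule K -> initial (sat m K) `<=` sat mG (initial K).
Proof.
move=> sK; have [sI _] := homogeneous_initial sK.
apply: initial_min => [|n z [u Hu] Pz]; first exact: submodule_sat.
exists u => g mg; suff: pow_ideal mG u `<=` transporter (t n z) (initial K)
  by apply.
apply: (pow_irrelevant_min sG) => [|i ui h Gh]; first exact: ideal_transporter.
have [a ma <-] := assoc_graded_ring_surj Gh.
rewrite /transporter /= assoc_graded_scale //; apply: sub_initial => //.
  by apply: Hu; apply: (@pow_mod_sub R R^o m _ _ ui).
exact: pow_mod_scale.
Qed.

(** Induction along the generation of gr M by its degree 0 part under multiplication by G_1, which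
    reflects m^(n+1) M = m (m^n M). *)
Lemma assoc_module_ind (Z : nat -> set N) : (forall n, submodule (Z n)) ->
  (forall z, Z 0%N (t 0%N z)) ->
  (forall n g y, Gg 1%N g -> Z n y -> Z n.+1 (g *: y)) ->
  forall n y, A n%:Z y -> Z n y.
Proof.
move=> sZ Z0 ZS n y /assoc_graded_surj[z Pz <-].
suff H : P n `<=` [set x | P n x /\ Z n (t n x)] by case: (H z Pz).
elim: n {z Pz y} => [//|n IH]; apply: smul_min => [|a z ma /IH[Pz Zz]].
  split; first by split; [apply: (submodule0 (sP _)) | rewrite assoc_graded0;
    apply: (submodule0 (sZ _))].
  move=> r u v [Pu Zu] [Pv Zv]; have Pru := submoduleZ r (sP _) Pu.
  split; first exact: (submoduleD (sP _)).
  rewrite assoc_gradedD //; apply: (submoduleD (sZ _)) => //.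
  by rewrite -[n.+1]add0n -assoc_graded_scale //; apply: (submoduleZ _ (sZ _)).
have m1a := mem_pow1 ma.
split; first by rewrite -add1n; apply: pow_mod_scale.
rewrite -add1n -assoc_graded_scale //; apply: ZS => //.
by case: agR => _ /(_ 1%N)[_ <- _] _ _; exists a.
Qed.

Lemma gpart_pow_mod n y : A n%:Z y -> (pow_mod mG n : set N) y.
Proof.
apply: assoc_module_ind n y => // [n|n g y Gg1]; first exact: submodule_pow_mod.
apply: mem_pow_modS; apply: (pow1_mem (irrelevant_ideal sG)).
exact: (std_pow sG).
Qed.

End InitialSubmodules.

(** * Comparison of the degrees of M / K and gr M / in K *)

Section DegreeComparison.
Variables (R G : comNzRingType) (m : set R) (Gg : nat -> set G) (s : nat -> R ->
  G).
Variables (M : lmodType R) (N : gmodType G) (t : nat -> M -> N).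
Hypotheses (nR : noetherian R) (nG : noetherian G) (nM : noetherian_module M).
Hypotheses (sm : ideal m) (sG : standard_grading Gg) (gN : graded_module Gg N).
Hypotheses (agR : assoc_graded_ring m Gg s) (agM : assoc_graded_module m s t).
Variables (adm : set M -> Prop) (V : set M -> set R) (beta : set M -> nat).
Variables (V' : set N -> set G) (beta' : set N -> nat).
Hypothesis dM : submodule_degree m adm V beta.
Hypothesis dN : submodule_degree (irrelevant Gg) (@homogeneous_submod G N)
  V' beta'.
Hypothesis adm_pow : forall K n, adm K -> adm (sum_set K (pow_mod m n)).
Hypothesis common_generic : forall K H, adm K -> sat m K `<=` K -> K <> setT ->
  homogeneous_submod H -> exists x, [/\ m x, V K x & V' H (s 1%N x)].
Implicit Types (K L : set M) (H : set N) (x : R) (z u v w : M) (y : N) (n :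
  nat).

Notation P n := (pow_mod m n : set M).
Notation A := (@gpart G N).
Notation mG := (irrelevant Gg).
Notation ini := (initial m t).

Let gA : grading A.
Proof. by case: gN. Qed.

Let sP n : submodule (P n).
Proof. exact: submodule_pow_mod. Qed.

Let sini K : submodule K -> submodule (ini K).
Proof. by move=> sK; case: (homogeneous_initial sG gN agR agM sK). Qed.

Lemma chain_initial_sat K l : adm K -> has_length K (sat m K) l ->
  submod_chain (ini K) (ini (sat m K)) l.
Proof.
move=> aK Hl; have sK := adm_submodule dM aK.
have sS := submodule_sat m sK.
(* The filtration of sat K / K induced by the powers of m is stationary by finite length, and
   Krull's theorem identifies its last term with K. *)
pose F n := sat m K `&` sum_set K (P n).
have FS n : F n.+1 `<=` F n.
  by move=> z [Sz Pz]; split=> //; apply: sum_setS Pz => //;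
    apply: pow_modS_sub.
have F_le i j : (i <= j)%N -> F j `<=` F i.
  move=> /subnK <-; elim: (j - i)%N => [//|q IH].
  exact: subset_trans (FS _) IH.
have [n0 Hn0] : exists n0, forall n, (n0 <= n)%N -> F n = F n0.
  apply: has_length_dcc Hl _ FS => n; split=> [||z []//].
    by apply: submoduleI => //; apply: submodule_sum_set.
  by move=> z Kz; split; [apply: sub_sat | apply: sub_sum_setl].
have FK : F n0 `<=` K.
  move=> z Fz; apply: (sat_pow_mod_inter nR nM sm sK) => [|n];
    first by case: Fz.
  have [nn0|/ltnW nn0] := leqP n0 n; first by case: (Hn0 n nn0) Fz => <- [].
  by case: (F_le _ _ nn0 _ Fz).
apply: (@submod_chain_map _ _ _ _ ini _ _ _ _ _ _ _ _ Hl.1).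
- by move=> B sB KB BS; split; [apply: sini | apply: initialS | apply:
    initialS].
- by move=> B C *; apply: initialS.
move=> B C sB sC KB CS BC iCB.
(* Successive approximation of C by B: the form of the error p lies in in C, hence in in B, and
   subtracting a lift from B raises the order of the error by one. The approximation to order n0 is
   then exact, by [FK]. *)
have CBP n : C `<=` sum_set B (P n).
  elim: n => [|n IH] z Cz; first by apply: sub_sum_setr.
  have [b [p [Bb Pp Ez]]] := IH z Cz.
  have Cp : C p by rewrite -[p](addKr b) -Ez addrC;
    apply: (submoduleB sC) => //; apply: BC.
  have /iCB := sub_initial gN agM sC Cp Pp.
  move/(initial_assoc_graded gN agM sB Pp) => [b' [p' [Bb' Pp' Ep]]].
  exists (b + b'), p'; split=> //; first exact: (submoduleD sB).
  by rewrite Ez Ep addrA.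
move=> z Cz; have [b [p [Bb Pp Ez]]] := CBP n0 z Cz.
rewrite Ez; apply: (submoduleD sB) => //; apply: KB; apply: FK; split.
  rewrite -[p](addKr b) -Ez addrC; apply: (submoduleB sS); first exact: CS.
  exact/CS/BC.
exact: sub_sum_setr.
Qed.

(** sat (in K) / in K has finite length, so its filtration induced by the powers of the irrelevant
    ideal is stationary from some c on. A form of degree n >= c in sat (in K) is then congruent
    modulo in K to an element of m_G^(n+1) gr M, which has no part of degree n. *)
Lemma sat_initial_deg K : submodule K ->
  exists c, forall n y, (c <= n)%N -> A n%:Z y -> sat mG (ini K) y -> ini K y.
Proof.
move=> sK; have hI := homogeneous_initial sG gN agR agM sK; have [sI hIp] := hI.
have [l Hl _] := degree_sat dN hI.
pose F n := sat mG (ini K) `&` sum_set (ini K) (pow_mod mG n).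
have sF n : submodule (F n).
  apply: submoduleI; first exact: submodule_sat.
  by apply: submodule_sum_set => //; apply: submodule_pow_mod.
have [c Hc] : exists c, forall n, (c <= n)%N -> F n = F c.
  apply: has_length_dcc Hl _ _ => [n|n z [Sz Pz]]; last first.
    by split=> //; apply: sum_setS Pz => //; apply: pow_modS_sub.
  split=> // [z Kz|z []//].
  by split; [apply: sub_sat | apply: sub_sum_setl => //;
    apply: submodule_pow_mod].
exists c => n y cn Ay Sy.
have : F n y.
  by split=> //; apply: sub_sum_setr => //; apply: (gpart_pow_mod sG agR agM).
rewrite (Hc n cn) -(Hc n.+1) ?leqW // => -[_ [u [v [Ku Pv Ey]]]].
rewrite -(gproj_id gA Ay) Ey (gprojD gA); apply: (submoduleD sI);
  first exact: hIp.
rewrite (pow_mod_gproj sG gN _ Pv) ?ltz_nat //; first exact: (submodule0 sI).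
by case: agM.
Qed.

(* In large degrees the initial submodule of K + x M is generated by that of K
   and by the initial form of x: the orders of the elements of (K + m^n M) : x
   are controlled modulo m^c M, where M / (K + m^c M) has finite length. *)
Lemma initial_generic K x : adm K -> m x ->
  (forall y, sat mG (ini K) (s 1%N x *: y) -> sat mG (ini K) y) ->
  ini (sum_set K (scale_set M x)) `<=`
    sat mG (sum_set (ini K) (scale_set N (s 1%N x))).
Proof.
move=> aK mx xreg; have sK := adm_submodule dM aK; have sI := sini sK.
have sx := @submodule_scale_set R M x.
set K' := sum_set K (scale_set M x); set H' := sum_set (ini K) _.
have sK' : submodule K' by apply: submodule_sum_set.
have sH' : submodule H' by apply: submodule_sum_set => //;
  apply: submodule_scale_set.
have sKP n : submodule (sum_set K (P n)) by apply: submodule_sum_set.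
have KPS i j : (i <= j)%N -> sum_set K (P j) `<=` sum_set K (P i).
  by move=> ij; apply: sum_setS => //; apply: pow_mod_sub.
have xx z : (scale_set M x) (x *: z) by exists z.
have [c Hc] := sat_initial_deg sK.
pose X n := scale_preim x (sum_set K (P n)).
have sX n : submodule (X n) by apply: submodule_scale_preim.
have KX n : K `<=` X n.
  by move=> z Kz; apply: sub_sum_setl => //; apply: (submoduleZ _ sK).
(* Every [W n] lies between K + m^c M and M, an interval of finite length because m^c carries M into
   K + m^c M. *)
pose W n := sum_set (X n) (P c).
have [n1 Hn1] : exists n1, forall n, (n1 <= n)%N -> W n = W n1.
  have [l Hl _] := degree_sat dM (adm_pow c aK).
  apply: has_length_dcc Hl _ _ => n; last first.
    by apply: sum_setS => // z; apply: KPS.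
  split; first exact: submodule_sum_set.
    exact: sum_setS.
  move=> z _; exists c => a ma; apply: sub_sum_setr => //.
  by rewrite -[c]addn0; apply: pow_mod_scale.
have key n y : (n1 <= n.+1)%N -> (c <= n)%N -> ini K' y -> A n.+1%:Z y -> H' y.
  move=> n1n cn /(_ n.+1) + Ay; rewrite (gproj_id gA Ay) => -[u [Ku Pu]
    <- {y Ay}].
  have [k0 [_ [Kk0 [v _ <-] Eu]]] := Ku.
  have Xv : X n.+1 v.
    exists (- k0), u; split=> //; first exact: (submoduleN sK).
    by rewrite Eu addKr.
  have : W n.+1 v by apply: sub_sum_setl.
  (* Order n + 2 instead of n + 1: x v' is then congruent modulo K to some p of order n + 2, and p
     has no class in degree n + 1. *)
  rewrite (Hn1 _ n1n) -(Hn1 n.+2 (leqW n1n)) => -[v' [w [Xv' Pw Ev]]].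
  have Xw : X n.+1 w.
    rewrite -[w](addKr v') -Ev addrC; apply: (submoduleB (sX _)) => //.
    exact: KPS Xv'.
  (* w starts in m^c M and is pushed up to order n modulo K, one order at a time. While w' has order
     i < n, x w' lies in K + m^(i+2) M, so y times the form of w' lies in in K; regularity of y puts
     that form in sat (in K), and degree at least c puts it in in K. *)
  have [k1 [w' [Kk1 Pw' Ew]]] : sum_set K (P n) w.
    suff H d : (c + d <= n)%N -> sum_set K (P (c + d)) w.
      by rewrite -(subnKC cn); apply: H; rewrite subnKC.
    elim: d => [|d IH] cdn; first by rewrite addn0; apply: sub_sum_setr.
    move: IH cdn; rewrite addnS; set i := (c + d)%N => IH lin.
    have [k1 [w' [Kk1 Pw' Ew]]] := IH (ltnW lin).
    have Pxw' : P i.+1 (x *: w') by apply: mem_pow_modS.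
    have Kxw' : sum_set K (P i.+2) (x *: w').
      have -> : w' = w - k1 by rewrite Ew addrC addKr.
      rewrite scalerBr; apply: (submoduleB (sKP _)); first exact: KPS Xw.
      exact: KX.
    have /(initial_assoc_graded gN agM sK Pw') [k2 [w2 [Kk2 Pw2 Ew']]] :
      ini K (t i w').
      apply: (Hc i); [exact: leq_addr | exact: (assoc_graded_in agM) |].
      apply: xreg; apply: (sub_sat mG sI).
      rewrite (assoc_graded_scale agM) //; last exact: mem_pow1.
      exact/(initial_assoc_graded gN agM sK Pxw').
    exists (k1 + k2), w2; split=> //; first exact: (submoduleD sK).
    by rewrite Ew Ew' addrA.
  have [k3 [p [Kk3 Pp Exv']]] := Xv'.
  (* With this k, u = k + x w' + p. Since u, x w' and p have order at least n + 1, so does k, and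
     its form lies in in K. *)
  pose k := k0 + k3 + x *: k1.
  have Kk : K k.
    by apply: (submoduleD sK); [apply: (submoduleD sK) | apply:
      (submoduleZ _ sK)].
  have Pxw' : P n.+1 (x *: w') by apply: mem_pow_modS.
  have Pp' := pow_modS_sub Pp.
  have Eu' : u = k + x *: w' + p.
    rewrite Eu Ev scalerDr Exv' Ew scalerDr /k -!addrA; congr (_ + (_ + _)).
    by rewrite addrC addrA.
  have Pk : P n.+1 k.
    have -> : k = u - p - x *: w' by rewrite Eu' addrK addrK.
    by do 2?[apply: (submoduleB (sP _)) => //].
  rewrite Eu' (assoc_gradedD agM) //; last exact: (submoduleD (sP _)).
  rewrite (iffRL (assoc_graded_eq0 agM Pp') Pp) addr0 (assoc_gradedD agM) //.
  exists (t n.+1 k), (t n.+1 (x *: w')); split=> //.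
    exact: (sub_initial gN agM).
  exists (t n w') => //; rewrite (assoc_graded_scale agM) //.
  exact: mem_pow1.
have [sJ hJ] := homogeneous_initial sG gN agR agM sK'.
(* A form of degree above the maximum of n1 and c carries a component of degree l >= 0 into a degree
   n + 1 with n >= n1 and n >= c, as [key] requires. *)
move=> y Jy; exists (maxn n1 c).+1 => g mg.
suff: pow_ideal mG (maxn n1 c).+1 `<=` transporter y H' by apply.
apply: (pow_irrelevant_min sG) => [|i ci h Gh]; first exact: ideal_transporter.
have [r [_ _ Ey]] := gproj_decomp gA y.
rewrite /transporter /= Ey scaler_sumr; apply: (submodule_sum sH') => -[l|l] _;
  last first.
  by rewrite (gproj_neg gN agM) // scaler0; apply: (submodule0 sH').
have [n En] : exists n, (i + l)%N = n.+1.
  by case: i ci {Gh} => // i _; exists (i + l)%N.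
have : (maxn n1 c < n.+1)%N by rewrite -En; apply: leq_trans ci (leq_addr _ _).
rewrite ltnS geq_max => /andP[n1n cn].
apply: (key n); [exact: leqW | by [] | |].
  by apply: (submoduleZ _ sJ); apply: hJ.
by rewrite -En PoszD; case: gN => _; apply=> //; apply: gproj_in.
Qed.

Lemma degree_le_initial K : adm K -> (beta K <= beta' (ini K))%N.
Proof.
move=> aK; move: (adm_submodule dM aK) (aK) => {aK}; move: K.
apply: (noeth_ind (P := fun K => adm K -> _) nM) => K sK IH aK.
have hI := homogeneous_initial sG gN agR agM sK.
have [sI _] := hI.
have [SK|nSK] := pselect (sat m K `<=` K); last first.
  have aS := adm_sat dM aK; have sS := adm_submodule dM aS.
  have KS : K `<=` sat m K by apply: sub_sat.
  have := IH _ sS (conj KS nSK) aS.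
  have [l Hl ->] := degree_sat dM aK.
  have [l1 Hl1 ->] := degree_sat dN hI.
  have hIS := homogeneous_initial sG gN agR agM sS.
  have [l2 Hl2 ->] := degree_sat dN hIS.
  (* Both right-hand degrees thus split over the same saturated submodule, and only the lengths l,
     l1 and l2 are left to compare. *)
  have ES : sat mG (ini (sat m K)) = sat mG (ini K).
    apply/seteqP; split; last exact/satS/initialS.
    apply: subset_trans (sat_sat nG sI).
    exact/satS/(initial_sat sG gN agR agM).
  rewrite ES in Hl2 * => le_beta.
  (* A chain of length l from in K to in (sat K), continued by one of length l2 up to sat (in K),
     gives l + l2 <= l1. *)
  have := has_length_chain Hl1 (submod_chain_cat (chain_initial_sat aK Hl)
    Hl2.1).
  rewrite addnC -(leq_add2l (beta' (sat mG (ini K)))) addnA.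
  by apply: leq_trans; rewrite leq_add2r.
have [->|nT] := pselect (K = setT); first by rewrite (degree_setT dM).
have hS := adm_sat dN hI; have [sS _] := hS.
have [x [mx Vx Vx']] := common_generic aK SK nT hS.
have SS := @sat_sat G mG N (ini K) nG sI.
set y := s 1%N x in Vx'.
rewrite (degree_generic dM aK SK Vx).
have aK' := adm_generic dM aK Vx; have sK' := adm_submodule dM aK'.
have sx := @submodule_scale_set R M x.
(* Strictness is what the induction hypothesis asks for: if x M were inside K, regularity of x
   modulo K would force K = M. *)
have KK' : K `<` sum_set K (scale_set M x).
  split; first exact: sub_sum_setl.
  move=> H; apply: nT; apply/seteqP; split=> // z _.
  apply: (generic_mod_regular dM aK SK Vx); apply: H.
  by apply: sub_sum_setr => //; exists z.
apply: leq_trans (IH _ sK' KK' aK') _.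
have hJ := homogeneous_initial sG gN agR agM sK'; have [sJ _] := hJ.
set J := ini _ in hJ sJ *.
pose H0 := sum_set (ini K) (scale_set N y).
pose H1 := sum_set (sat mG (ini K)) (scale_set N y).
have sy := @submodule_scale_set G N y.
have sH0 : submodule H0 by apply: submodule_sum_set.
have hH1 : homogeneous_submod H1 := adm_generic dN hS Vx'; have [sH1 _] := hH1.
have H01 : H0 `<=` H1 by apply: sum_setS => //; apply: sub_sat.
have H0J : H0 `<=` J.
  apply: sum_set_min => //; first by apply: initialS; case: KK'.
  move=> _ [z _ <-]; have [r [_ _ ->]] := gproj_decomp gA z.
  rewrite scaler_sumr; apply: (submodule_sum sJ) => -[n|n] _; last first.
    by rewrite (gproj_neg gN agM) // scaler0; apply: (submodule0 sJ).
  have [u Pu <-] := assoc_graded_surj agM (gproj_in gA n%:Z z).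
  rewrite (assoc_graded_scale agM) //; last exact: mem_pow1.
  apply: (sub_initial gN agM) => //; last exact: mem_pow_modS.
  by apply: sub_sum_setr => //; exists u.
have H1S : H1 `<=` sat mG H0.
  apply: sum_set_min; first exact: submodule_sat.
    by apply: satS; apply: sub_sum_setl.
  by apply: subset_trans (sub_sat _ sH0); apply: sub_sum_setr.
have JS : J `<=` sat mG H0.
  apply: initial_generic => // z.
  exact: (generic_mod_regular dN hS SS Vx').
have ESJ : sat mG J = sat mG H0.
  apply/seteqP; split; last exact: satS.
  by apply: subset_trans (sat_sat nG sH0); apply: satS.
have ES1 : sat mG H1 = sat mG H0.
  apply/seteqP; split; last exact: satS.
  by apply: subset_trans (sat_sat nG sH0); apply: satS.
have [l1 Hl1 ->] := degree_sat dN hI.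
rewrite (degree_generic dN hS SS Vx') -/H1.
have [l2 Hl2 ->] := degree_sat dN hJ; have [l3 Hl3 ->] := degree_sat dN hH1.
(* With S = sat H0, it remains to show l2 <= l3 + l1 for the lengths of S / J, S / H1 and sat (in K)
   / in K. A chain from J to S is a chain from H0 to S, and it is cut at H1. *)
rewrite ESJ ES1 in Hl2 Hl3 *; rewrite -addnA leq_add2l.
have [p [q [lpq Hp Hq]]] := submod_chain_split sH1 (submodule_sat mG sH0)
  H01 H1S
  (submod_chainS H0J (@subset_refl _ _) Hl2.1).
apply: leq_trans lpq _; rewrite addnC; apply: leq_add.
  exact: has_length_chain Hl3 Hq.
apply: has_length_chain Hl1 _.
(* H1 / H0 is a quotient of sat (in K) / in K, since H1 = sat (in K) + y gr M and H0 contains y gr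
   M. Pulling back along this surjection is intersecting with sat (in K). *)
apply: (@submod_chain_map _ _ _ _ (fun B => B `&` sat mG (ini K))
  _ _ _ _ _ _ _ _ Hp).
- move=> B sB H0B _; split; [exact: submoduleI | | by move=> z []].
  move=> z Iz; split; last exact: sub_sat.
  by apply: H0B; apply: sub_sum_setl.
- by move=> B C _ _ _ _ _ _ BC z [/BC Cz Sz].
move=> B C sB sC H0B CH1 BC H z Cz.
have [a [b [Sa yb Ez]]] := CH1 z Cz.
have Bb : B b by apply: H0B; apply: sub_sum_setr.
rewrite Ez; apply: (submoduleD sB) => //.
suff: (B `&` sat mG (ini K)) a by case.
apply: H; split=> //; have -> : a = z - b by rewrite Ez addrK.
by apply: (submoduleB sC) => //; apply: BC.
Qed.

End DegreeComparison.

(** * Noetherian algebras *)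

Section HilbertBasis.

Lemma noetherian_field (k : fieldType) : noetherian k.
Proof.
move=> I sI; have [[a Ia a0]|H] := pselect (exists2 a, I a & a != 0).
  exists [:: a]; apply/seteqP; split=> [b Ib|]; last first.
    by apply: span_min => // b /=; rewrite mem_seq1 => /eqP ->.
  rewrite -[b](divfK a0); apply: (submoduleZ _ (@submodule_span k k^o _)).
  by apply: sub_span; rewrite /= mem_seq1.
exists [::]; apply/seteqP; split=> [b Ib|]; last by apply: span_min.
have [->|b0] := eqVneq b 0; last by case: H; exists b.
exact: (submodule0 (submodule_span _)).
Qed.

(** Hilbert's argument: the ideals [lc n] of coefficients at degree n of polynomials in I of degree
    at most n increase and are stationary from some n0. Lifts of generators of [lc n] for n <= n0
    generate I, by cancelling top coefficients. *)
Lemma noetherian_poly (A : comNzRingType) : noetherian A -> noetherian {poly A}.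
Proof.
move=> nA I sI.
pose lc n : set A := [set a | exists f : {poly A}, [/\ I f,
  (size f <= n.+1)%N & f`_n = a]].
have s_lc n : ideal (lc n).
  split; first by exists 0; split; [apply: (submodule0 sI)
    | rewrite size_poly0 | rewrite coef0].
  move=> c _ _ [f [If sf <-]] [g [Ig sg <-]]; exists (c *: f + g); split.
  - by rewrite -mul_polyC; apply: (submoduleD sI) => //; apply: idealM.
  - by rewrite (leq_trans (size_polyD _ _))
      // geq_max sg (leq_trans (size_scale_leq _ _)).
  - by rewrite coefD coefZ.
have lcS n : lc n `<=` lc n.+1.
  move=> _ [f [If sf <-]]; exists ('X * f); split; first exact: idealM.
    by rewrite (leq_trans (size_polyMleq _ _)) // size_polyX addSn.
  by rewrite coefXM.
have [n0 Hn0] := @noeth_acc A A^o lc nA s_lc lcS.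
have /choice[S HS] n : exists s : seq {poly A}, (forall g, g \in s -> I g) /\
    forall a, lc n a -> exists g,
      [/\ @span {poly A} {poly A}^o [set h | h \in s] g,
      (size g <= n.+1)%N & g`_n = a].
  have [s Hs] := nA _ (s_lc n).
  have /choice[F HF] (i : 'I_(size s)) : exists f, [/\ I f,
    (size f <= n.+1)%N & f`_n = s`_i].
    have: lc n s`_i by rewrite Hs; apply: sub_span; apply: mem_nth.
    by case=> f; exists f.
  exists (codom F); split=> [g /codomP[i ->]|a]; first by case: (HF i).
  rewrite Hs => /fin_genP[c ->]; exists (\sum_(i < size s) (c i)%:P * F i);
    split.
  - apply: (submodule_sum (submodule_span _)) => i _.
    apply: (submoduleZ _ (@submodule_span {poly A} {poly A}^o _)).
    by apply: sub_span; apply: codom_f.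
  - apply: (leq_trans (size_sum _ _ _)); apply/bigmax_leqP => i _.
    rewrite mul_polyC (leq_trans (size_scale_leq _ _)) //; by case: (HF i).
  - rewrite coef_sum; apply: eq_bigr => i _; rewrite coefCM.
    by case: (HF i) => _ _ ->.
pose T := flatten [seq S n | n <- iota 0 n0.+1].
have sT := @submodule_span {poly A} {poly A}^o [set h | h \in T].
exists T; apply/seteqP; split; last first.
  apply: (@span_min {poly A} {poly A}^o) => // g /= /flattenP[_ /mapP[n _ ->]];
    by case: (HS n) => H _ /H.
have subT n : (n <= n0)%N -> @span {poly A} {poly A}^o [set h | h \in S n] `<=`
  @span {poly A} {poly A}^o [set h | h \in T].
  move=> nn0; apply: (@span_min {poly A} {poly A}^o _ _ sT) => g gS;
    apply: sub_span => /=.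
  by apply/flattenP; exists (S n) => //; apply: map_f; rewrite mem_iota.
have spanI n : @span {poly A} {poly A}^o [set h | h \in S n] `<=` I.
  by apply: (@span_min {poly A} {poly A}^o) => //; case: (HS n).
suff H q (f : {poly A}) : I f -> (size f <= q)%N ->
  @span {poly A} {poly A}^o [set h | h \in T] f.
  by move=> f If; apply: (H (size f)).
elim: q f => [|q IH] f If.
  by rewrite leqn0 size_poly_eq0 => /eqP ->; apply: (submodule0 sT).
move=> sf; have [g [Tg Ig sg gq]] : exists g : {poly A},
    [/\ @span {poly A} {poly A}^o [set h | h \in T] g, I g,
      (size g <= q.+1)%N & g`_q = f`_q].
  have lcf : lc q f`_q by exists f.
  have [qn0|n0q] := leqP q n0.
    have [_ /(_ _ lcf)[g [Sg sg gq]]] := HS q.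
    by exists g; split=> //; [apply: (subT q) | apply: (spanI q)].
  have [_ /(_ _ (Hn0 _ _ lcf))[g [Sg sg gq]]] := HS n0.
  (* Above n0 no new top coefficients occur, so a polynomial from level n0 is shifted up to degree
     q. *)
  exists ('X^(q - n0) * g); split.
  - by apply: (submoduleZ _ sT); apply: (subT n0).
  - by apply: idealM => //; apply: (spanI n0).
  - rewrite (leq_trans (size_polyMleq _ _)) // size_polyXn addSn /=.
    by rewrite (leq_trans (leq_add (leqnn _) sg)) // addnS subnK // ltnW.
  - by rewrite coefXnM ltnNge leq_subr /= subKn // ltnW.
rewrite -(subrK g f); apply: (submoduleD sT) => //; apply: IH.
  exact: (submoduleB sI).
apply/leq_sizeP => j; rewrite leq_eqVlt => /predU1P[<-|qj]; rewrite coefB.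
  by rewrite gq subrr.
by rewrite !nth_default ?subrr // (leq_trans _ qj).
Qed.

Lemma noetherian_surj (A B : comNzRingType) (f : {rmorphism A -> B}) :
  range f = setT -> noetherian A -> noetherian B.
Proof.
move=> fT nA I sI.
have sfI : ideal (f @^-1` I).
  split; first by rewrite /preimage /= rmorph0; apply: (submodule0 sI).
  move=> a u v Iu Iv; rewrite /preimage /= rmorphD rmorphM.
  by apply: (submoduleD sI) => //; apply: idealM.
have [s Hs] := nA _ sfI; exists (map f s).
have sS := @submodule_span B B^o [set y | y \in map f s].
apply/seteqP; split=> [b Ib|]; last first.
  apply: span_min => // _ /= /mapP[a sa ->].
  suff: (f @^-1` I) a by [].
  by rewrite Hs; apply: sub_span.
have [a _ def_b] : range f b by rewrite fT.
suff: f @^-1` I `<=` f @^-1` (@span B B^o [set y | y \in map f s]).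
  by rewrite -def_b in Ib *; apply.
rewrite Hs; apply: (@span_min A A^o) => [|c cs]; last first.
  by apply: sub_span; apply: map_f.
split; first by rewrite /preimage /= rmorph0; apply: (submodule0 sS).
move=> c u v Iu Iv; rewrite /preimage /= rmorphD rmorphM.
by apply: (submoduleD sS) => //; apply: (submoduleZ _ sS).
Qed.

(** B is the image of an iterated polynomial ring over k, built with its map by recursion on [xs];
    the generation hypothesis is applied to the range of the map. *)
Lemma noetherian_algebra (k : fieldType) (B : comAlgType k) (xs : seq B) :
  (forall S : set B, S 1 -> (forall c a b, S a -> S b -> S (c *: a + b)) ->
     (forall a b, S a -> S b -> S (a * b)) -> (forall x, x \in xs -> S x) ->
     S = setT) ->
  noetherian B.
Proof.
move=> genB.
suff [A [f [nA fk fxs]]] : exists (A : comNzRingType) (f : {rmorphism A -> B}),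
    [/\ noetherian A, forall c : k, range f c%:A & forall x, x \in xs ->
      range f x].
  apply: (noetherian_surj (f := f) _ nA); apply: genB => //.
  - by exists 1; rewrite ?rmorph1.
  - move=> c _ _ [u _ <-] [v _ <-]; have [w _ fw] := fk c.
    by exists (w * u + v); rewrite // rmorphD rmorphM fw mulr_algl.
  - by move=> _ _ [u _ <-] [v _ <-]; exists (u * v); rewrite ?rmorphM.
elim: (xs) => [|x ys [A [f [nA fk fys]]]].
  exists k, (in_alg B); split=> //; exact: noetherian_field.
have cfx : commr_rmorph f x by move=> a; apply: mulrC.
exists {poly A}, (horner_morph cfx); split; first exact: noetherian_poly.
  by move=> c; have [a _ <-] := fk c; exists a%:P; rewrite //= horner_morphC.
move=> y; rewrite inE => /predU1P[->|/fys[a _ <-]].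
  by exists 'X; rewrite //= horner_morphX.
by exists a%:P; rewrite //= horner_morphC.
Qed.

End HilbertBasis.

Lemma Rg_irrelevant (R : comNzRingType) (Rg : nat -> set R) i :
  grading Rg -> (0 < i)%N -> Rg i `<=` irrelevant Rg.
Proof.
move=> gR i0 a Ra; exists i.+1, (fun j => if j == i then a else 0); split.
  by move=> j; case: eqP => [->|_] //; apply: (grading0 gR).
rewrite big_nat_recr //= eqxx big_nat_cond big1 ?add0r // => j /andP[/andP[_ ji]
  _].
by rewrite ltn_eqF.
Qed.

(** The elements whose degree i component lies in m^i for every i form a subalgebra containing R_1,
    hence all of R. *)
Lemma homogeneous_standard (k : fieldType) (R : comAlgType k) (Rg : nat ->
  set R) :
  homogeneous_algebra Rg -> standard_grading Rg.
Proof.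
move=> [gR mulR R0 _ genR]; split=> //.
have sm i : ideal (pow_ideal (irrelevant Rg) i) by apply: ideal_pow.
pose S := [set a | forall i, pow_ideal (irrelevant Rg) i (gproj Rg i a)].
have S0 c : S c%:A.
  have R0c : Rg 0%N c%:A by rewrite R0; exists c.
  case=> [//|i]; rewrite (gproj_neq gR R0c) //; exact: (submodule0 (sm _)).
have SM a b : S a -> S b -> S (a * b).
  move=> Sa Sb i; have [r [_ _ ->]] := gproj_decomp gR a.
  have [r' [_ _ ->]] := gproj_decomp gR b.
  rewrite mulr_suml (gproj_sum gR); apply: (submodule_sum (sm i)) => j _.
  rewrite mulr_sumr (gproj_sum gR); apply: (submodule_sum (sm i)) => l _.
  have Rjl := mulR j l _ _ (gproj_in gR j a) (gproj_in gR l b).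
  have [->|ijl] := eqVneq i (j + l)%N.
    by rewrite (gproj_id gR Rjl); apply: (@pow_mod_scale R _ R^o _ _ _ _ (Sa j)
      (Sb l)).
  by rewrite (gproj_neq gR Rjl) //; apply: (submodule0 (sm _)).
have ST : S = setT.
  apply: genR => //; first by rewrite -[1]scale1r.
    move=> c a b Sa Sb i; rewrite (gprojD gR) -mulr_algl.
    by apply: (submoduleD (sm i)) => //; apply: SM.
  move=> a R1a i; have [->|i1] := eqVneq i 1%N; last first.
    by rewrite (gproj_neq gR R1a) //; apply: (submodule0 (sm _)).
  by rewrite (gproj_id gR R1a); apply: mem_pow1; apply: Rg_irrelevant R1a.
move=> i a Ra; rewrite -(gproj_id gR Ra).
by have : S a by rewrite ST.
Qed.

(** * Structure of the associated graded ring and module *)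

Section AssociatedGraded.
Variables (R G : comNzRingType) (m : set R) (Gg : nat -> set G) (s : nat -> R ->
  G).
Hypothesis agR : assoc_graded_ring m Gg s.

Let pieceR i : [/\ forall x y, pow_ideal m i x -> pow_ideal m i y -> s i (x + y)
  = s i x + s i y,
  s i @` pow_ideal m i = Gg i
  & forall x, pow_ideal m i x -> (s i x = 0 <-> pow_ideal m i.+1 x)].
Proof. by case: agR => _ /(_ i). Qed.

Lemma assoc_ring_mul i j a b : pow_ideal m i a -> pow_ideal m j b ->
  s i a * s j b = s (i + j)%N (a * b).
Proof. by case: agR => _ _ _; apply. Qed.

Lemma assoc_ring_in i a : pow_ideal m i a -> Gg i (s i a).
Proof. by case: (pieceR i) => _ <- _ ma; exists a. Qed.

Lemma assoc_ringD i a b : pow_ideal m i a -> pow_ideal m i b ->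
  s i (a + b) = s i a + s i b.
Proof. by case: (pieceR i) => + _ _; apply. Qed.

Lemma assoc_ring_eq0 i a : pow_ideal m i.+1 a -> s i a = 0.
Proof.
move=> ma; have [_ _ H] := pieceR i; apply/H => //.
exact: (@pow_modS_sub R R^o).
Qed.

Lemma assoc_ring0 i : s i 0 = 0.
Proof. by apply: assoc_ring_eq0; apply: (submodule0 (ideal_pow m i.+1)). Qed.

Lemma assoc_ring_sum i (T : Type) (r : seq T) (F : T -> R) :
  (forall x, pow_ideal m i (F x)) ->
  s i (\sum_(x <- r) F x) = \sum_(x <- r) s i (F x).
Proof.
move=> mF; elim: r => [|x r IH]; first by rewrite !big_nil assoc_ring0.
rewrite !big_cons assoc_ringD ?IH //.
by apply: (submodule_sum (ideal_pow m i)).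
Qed.

(** Induction along the generation of gr_m(R) by G_1 over G_0, inherited from m^(i+1) = m m^i. *)
Lemma assoc_ring_ind (Z : nat -> set G) : Gg 0%N `<=` Z 0%N ->
  (forall i, Z i 0) -> (forall i g h, Z i g -> Z i h -> Z i (g + h)) ->
  (forall i g h, Gg 0%N g -> Z i h -> Z i (g * h)) ->
  (forall i g h, Gg 1%N g -> Z i h -> Z i.+1 (g * h)) ->
  forall i, Gg i `<=` Z i.
Proof.
move=> Z0 Z_0 ZD Zscale ZS; elim=> [//|i IH] g.
have [_ <- _] := pieceR i.+1 => -[a ma <-].
pose L : set R := [set a | pow_ideal m i.+1 a /\ Z i.+1 (s i.+1 a)].
suff: pow_ideal m i.+1 `<=` L by move=> /(_ a ma)[].
have sm := ideal_pow m i.+1.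
apply: (@smul_min R R^o m _ (L : set R^o)) => [|b c mb mc].
  split; first by split; [apply: (submodule0 sm) | rewrite assoc_ring0].
  move=> r u v [mu Zu] [mv Zv].
  have mru : pow_ideal m i.+1 (r * u) := idealM r sm mu.
  split; first exact: (submoduleD sm).
  rewrite assoc_ringD //; apply: ZD => //.
  rewrite -[i.+1]add0n -assoc_ring_mul //; apply: Zscale => //.
  exact: assoc_ring_in.
have m1b := mem_pow1 mb.
split; first exact: (@mem_pow_modS R R^o).
rewrite -[b *: c]/(b * c) -add1n -assoc_ring_mul //; apply: ZS.
  exact: assoc_ring_in.
by apply: IH; apply: assoc_ring_in.
Qed.

Lemma assoc_ring_standard : standard_grading Gg.
Proof.
have gG : grading Gg by case: agR.
have sm i : ideal (pow_ideal (irrelevant Gg) i) by apply: ideal_pow.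
split=> // [i j g h|].
  have [_ <- _] := pieceR i; have [_ <- _] := pieceR j => -[a ma <-] [b mb <-].
  rewrite assoc_ring_mul //; apply: assoc_ring_in.
  exact: (@pow_mod_scale R m R^o).
apply: assoc_ring_ind => // [i|i g h mg mh|i g h _ mh|i g h Gg1 mh].
- exact: (submodule0 (sm i)).
- exact: (submoduleD (sm i)).
- exact: (idealM _ (sm i)).
- by apply: (@mem_pow_modS G G^o) => //; apply: Rg_irrelevant Gg1.
Qed.

Lemma assoc_module_graded (M : lmodType R) (N : gmodType G) (t : nat -> M -> N)
  :
  assoc_graded_module m s t -> graded_module Gg N.
Proof.
move=> [gN Nneg pN tM]; split=> // i [j|j] g z; last first.
  by rewrite Nneg => _ ->; rewrite scaler0; apply: grading0.
have [_ <- _] := pieceR i; have [_ <- _] := pN j => -[a ma <-] [x Px <-].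
rewrite tM // -PoszD; have [_ <- _] := pN (i + j)%N.
by exists (a *: x) => //; apply: pow_mod_scale.
Qed.

(** The degree 0 classes of generators of M span the degree 0 part of N, and this part generates
    N. *)
Lemma assoc_module_fin_gen (M : lmodType R) (N : gmodType G) (t : nat -> M -> N)
  :
  assoc_graded_module m s t -> fin_gen [set: M] -> fin_gen [set: N].
Proof.
move=> agM [r Hr]; have gN := assoc_module_graded agM.
exists (map (t 0%N) r).
set L := span _; have sL : submodule L by apply: submodule_span.
have L0 z : L (t 0%N z).
  suff: [set: M] `<=` [set z | L (t 0%N z)] by apply.
  rewrite Hr; apply: span_min => [|x xr]; last by apply: sub_span; apply: map_f.
  split=> [|c u v Lu Lv] /=.
    by rewrite (assoc_graded0 agM); apply: (submodule0 sL).
  rewrite (assoc_gradedD agM) //; apply: (submoduleD sL) => //.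
  by rewrite -[0%N]add0n -(assoc_graded_scale agM) //; apply: (submoduleZ _ sL).
apply/seteqP; split=> // y _; have [gA _] := gN.
have [q [_ _ ->]] := gproj_decomp gA y; apply: (submodule_sum sL) => -[n|j] _;
  last first.
  by rewrite (gproj_neg gN agM) //; apply: (submodule0 sL).
apply: (assoc_module_ind agR agM (Z := fun=> L)) (gproj_in gA _ _) => //.
by move=> _ g z _; apply: (submoduleZ _ sL).
Qed.

End AssociatedGraded.

(** * Generic elements *)

Section GenericPoints.
Variables (k : fieldType) (k_infinite : infinite_set [set: k]).

Lemma horner_neq0_exists (p : {poly k}) : p != 0 -> exists x, p.[x] != 0.
Proof.
move=> p0; apply: contrapT => /forallNP Hp.
have [B _ sB] := infinite_set_fset (size p) k_infinite.
have rB : all (root p) (finmap.enum_fset B).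
  by apply/allP => x _; apply/negPn/negP; apply: Hp.
by have := max_poly_roots p0 rB (finmap.fset_uniq B); rewrite ltnNge sB.
Qed.

Lemma meval_line n (F : {mpoly k[n]}) (c d : 'I_n -> k) :
  exists p : {poly k}, forall x, p.[x] = F.@[fun i => c i + x * (d i - c i)].
Proof.
exists (\sum_(a <- msupp F) (F@_a)%:P *
   \prod_i ((c i)%:P + 'X * (d i - c i)%:P) ^+ a i) => x.
rewrite mevalE horner_sum; apply: eq_bigr => a _.
rewrite hornerM hornerC horner_prod; congr (_ * _); apply: eq_bigr => i _.
by rewrite horner_exp !hornerE.
Qed.

(** O is given in coordinates for a family w that only spans B, O' in coordinates for a basis. The
    line joining a point of O to a lift of a point of O' turns both conditions into nonzero
    polynomials in one variable, whose product has a non-root in the infinite field. *)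
Lemma generic_common (W : lmodType k) n n' (w : 'I_n -> W) (e : 'I_n' -> W)
    (B : set W) O O' :
  zariski_open O -> O !=set0 -> zariski_open O' -> O' !=set0 ->
  basis_of B e -> (forall i, B (w i)) ->
  (forall z, B z -> exists c, z = \sum_i c i *: w i) ->
  exists c c', [/\ O c, O' c' & \sum_i c i *: w i = \sum_i c' i *: e i].
Proof.
move=> [S ->] [c1 [F SF Fc1]] [S' ->] [c2' [F' SF' Fc2]] [BE free_e] Bw span_w.
have /choice[l Hl] i : exists a : 'I_n' -> k, w i = \sum_j a j *: e j.
  by have := Bw i; rewrite BE => -[a _ <-]; exists a.
pose L (c : 'I_n -> k) j := \sum_i c i * l i j.
have LE c : \sum_i c i *: w i = \sum_j L c j *: e j.
  under eq_bigr do rewrite Hl scaler_sumr.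
  rewrite exchange_big; apply: eq_bigr => j _; rewrite scaler_suml.
  by apply: eq_bigr => i _; rewrite scalerA.
have [c2 Ec2] : exists c, \sum_j c2' j *: e j = \sum_i c i *: w i.
  by apply: span_w; rewrite BE; exists c2'.
have Lc2 j : L c2 j = c2' j.
  apply/eqP; rewrite -subr_eq0; apply/eqP.
  apply: (free_e (fun j => L c2 j - c2' j)).
  under eq_bigr do rewrite scalerBl.
  by rewrite sumrB -LE Ec2 subrr.
(* The value x = 0 witnesses that F is nonzero on the line, and x = 1 that F' is nonzero on its
   image. *)
pose line x i := c1 i + x * (c2 i - c1 i).
have Lline x j : L (line x) j = L c1 j + x * (L c2 j - L c1 j).
  rewrite -sumrB mulr_sumr -big_split /=; apply: eq_bigr => i _.
  by rewrite mulrDl -mulrA mulrBl.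
have [p Hp] := meval_line F c1 c2; have [q Hq] := meval_line F' (L c1) (L c2).
have p0 : p != 0.
  apply/eqP => p0; case/eqP: Fc1; rewrite -[RHS](horner0 0) -p0 Hp.
  by apply: meval_eq => i; rewrite mul0r addr0.
have q0 : q != 0.
  apply/eqP => q0; case/eqP: Fc2; rewrite -[RHS](horner0 1) -q0 Hq.
  by apply: meval_eq => i; rewrite mul1r addrC subrK Lc2.
have [x] := horner_neq0_exists (mulf_neq0 p0 q0).
rewrite hornerM mulf_eq0 negb_or => /andP[px qx].
exists (line x), (L (line x)); split; [by exists F;
  rewrite // -Hp | | exact: LE].
exists F' => //; move: qx; rewrite Hq.
by rewrite (meval_eq (v2 := L (line x))).
Qed.

End GenericPoints.

(** * From the axioms of bdeg in the two categories to the comparison *)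

Lemma initial_set0 (R G : comNzRingType) (m : set R) (s : nat -> R -> G)
    (M : lmodType R) (N : gmodType G) (t : nat -> M -> N) :
  assoc_graded_module m s t -> initial m t [set 0] = [set 0].
Proof.
move=> agM; have [gA _ _ _] := agM; have t0 := assoc_graded0 agM.
apply/seteqP; split=> [y Hy|_ -> n]; last first.
  exists 0; last by rewrite (gproj0 gA).
  by split=> //; apply: (submodule0 (@submodule_pow_mod R M m n)).
apply: (gproj_eq0 gA) => -[n|j]; first by have [z [-> _] <-] := Hy n.
by have := gproj_in gA (Negz j) y; case: agM => _ -> _ _.
Qed.

(** Serves both for gr_m(M) over gr_m(R) and, in the homogeneous case, for M over R. The final
    equation replaces M by M / 0, so that M itself is one of the quotients. *)
Lemma graded_submodule_degree (k : fieldType) (R : comAlgType k)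
    (Rg : nat -> set R) (M : gmodType R) (U : gmodType R -> set R)
    (b : gmodType R -> nat) :
  noetherian R -> standard_grading Rg -> graded_module_cat Rg M ->
  graded_genericity Rg U ->
  bdeg_axioms (irrelevant Rg) (graded_module_cat Rg) (@gquotient_of R) U b ->
  submodule_degree (irrelevant Rg) (@homogeneous_submod R M)
    (U \o @quotg R M) (b \o @quotg R M) /\ b M = b (quotg [set (0 : M)]).
Proof.
move=> nR sR [fgM gM] [_ Ugen Ureg] bax.
have QC K : homogeneous_submod K -> graded_module_cat Rg (@quotg R M K).
  move=> hK; split; last exact: quotg_graded.
  by case: hK => sK _; apply: fin_gen_quotient (quotm_classP sK) fgM.
split; last first.
  case: bax => biso _ _ _; apply: biso; first by [].
  exists (@quotm_class R M [set 0]); split=> //.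
  exact/quotm_classP/submodule_set0.
pose f K : {linear M -> quotm K} := @quotm_class R M K.
have Cfg A : graded_module_cat Rg A -> fin_gen [set: A] by case.
apply: (@submodule_degree_of_bdeg R (irrelevant Rg) M _ (@gmod_sort R) _ _ U b _
  (@quotg R M) f nR (irrelevant_ideal sR) Cfg bax Ureg) => //.
- by move=> K [].
- by move=> K hK; apply: (homogeneous_sat sR gM).
- move=> K x hK Ux; apply: (homogeneous_submod_scale gM) (hK).
  by have [_ UR _] := Ugen _ (QC K hK); apply: UR Ux.
- by move=> K [sK _]; apply: quotm_classP.
move=> K K' [sK _] [sK' _] KK'; have [h hq hE] := quotm_factor sK sK' KK'.
exists h; split=> // j; apply/seteqP; split=> [_ [_ [z Az <-] <-]|_ [z Az <-]].
  by exists z; rewrite ?hE.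
by exists (quotm_class K z); [exists z | rewrite hE].
Qed.

Lemma local_submodule_degree (k : fieldType) (R : comNzRingType) (m : set R)
    (pi : {rmorphism R -> k}) (M : lmodType R) (U : lmodType R -> set R)
    (b : lmodType R -> nat) :
  noetherian R -> ideal m -> module_cat M -> local_genericity m pi U ->
  bdeg_axioms m (@module_cat R) (@quotient_of R) U b ->
  submodule_degree m (@submodule R M) (U \o @quotm R M) (b \o @quotm R M) /\
    b M = b (quotm [set (0 : M)]).
Proof.
move=> nR sm fgM [_ _ _ _ Ureg] bax; split; last first.
  case: bax => biso _ _ _; apply: biso; first by [].
  by exists (@quotm_class R M [set 0]); apply/quotm_classP/submodule_set0.
pose f K : {linear M -> quotm K} := @quotm_class R M K.
apply: (@submodule_degree_of_bdeg R m M _ id (@module_cat R) _ U b _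
  (@quotm R M) f nR sm _ bax Ureg) => //.
- exact: submodule_sat.
- move=> K x sK _; apply: submodule_sum_set => //; exact: submodule_scale_set.
- by move=> K sK; apply: fin_gen_quotient (quotm_classP sK) fgM.
- exact: quotm_classP.
by move=> K K' sK sK' KK'; have [h hq _] := quotm_factor sK sK' KK'; exists h.
Qed.

Lemma local_ring_ideal (R : comNzRingType) (m : set R) : local_ring m ->
  ideal m.
Proof.
move=> lm; have : [set m] m by [].
by rewrite -lm => -[].
Qed.

(** If 1 - a generated a proper ideal, that ideal would lie in a maximal one, necessarily m, and
    then 1 would be in m. *)
Lemma local_ring_unit (R : comNzRingType) (m : set R) a :
  noetherian R -> local_ring m -> m a -> exists u, u * (1 - a) = 1.
Proof.
move=> nR lm ma; have [_ nm1 _] : maximal_ideal m by have : [set m] m by [];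
  rewrite -lm.
have sm := local_ring_ideal lm.
have [[u _ Eu]|n1] := pselect (scale_set R^o (1 - a) 1); first by exists u;
  rewrite mulrC.
pose Q (J : set R^o) := scale_set R^o (1 - a) `<=` J /\ ~ J 1.
have [J [sJ [aJ nJ1] maxJ]] := noeth_max (Q := Q) nR
  (@submodule_scale_set R R^o (1 - a)) (conj (@subset_refl _ _) n1).
have : [set I | maximal_ideal I] J.
  split=> // J' sJ' nJ'1 JJ'; apply: maxJ => //; split=> //.
  exact: subset_trans JJ'.
rewrite lm => /= EJ; case: nm1; rewrite -[1](subrK a).
apply: (submoduleD sm) => //; rewrite -EJ; apply: aJ.
by exists 1; rewrite //= /GRing.scale /= mulr1.
Qed.

(** G_0 consists of scalars and G_1 generates G over G_0, so a basis of G_1 generates the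
    algebra. *)
Lemma assoc_ring_noetherian (k : fieldType) (G : comAlgType k) (R :
  comNzRingType)
    (m : set R) (Gg : nat -> set G) (s : nat -> R -> G) n (e : 'I_n -> G) :
  assoc_graded_ring m Gg s -> (forall r, exists c : k, s 0%N r = c%:A) ->
  basis_of (Gg 1%N) e -> noetherian G.
Proof.
move=> agR s0 [G1 _]; apply: (noetherian_algebra (xs := codom e)) =>
  S S1 SL SM Se.
have SD a b : S a -> S b -> S (a + b) by move=> Sa Sb; rewrite -[a]scale1r;
  apply: SL.
have SA (c : k) : S c%:A.
  have S0 : S 0 by rewrite -[0](addNr 1) -scaleN1r; apply: SL.
  by rewrite -[c%:A]addr0; apply: SL.
have G0S : Gg 0%N `<=` S.
  case: agR => _ /(_ 0%N)[_ <- _] _ _ _ [a _ <-].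
  by have [c ->] := s0 a.
have S0 : S 0 by rewrite -(scale0r 1); apply: SA.
have G1S : Gg 1%N `<=` S.
  rewrite G1 => _ [c _ <-]; apply: (big_ind S) => // i _.
  by rewrite -mulr_algl; apply: SM => //; apply: Se; apply: codom_f.
have GS : forall i, Gg i `<=` S.
  apply: (assoc_ring_ind agR (Z := fun=> S)) => // i g h Gg0 Sh;
    apply: SM => //.
    exact: G0S.
  exact: G1S.
have gG : grading Gg by case: agR.
apply/seteqP; split=> // g _; have [r [_ _ ->]] := gproj_decomp gG g.
by apply: (big_ind S) => // i _; apply: (GS i); apply: gproj_in.
Qed.

(** The part common to both cases. The last hypothesis describes genericity for M / K inside G_1:
    every point of a nonempty open set of coordinates is realised as the initial form of some x
    generic for M / K. It is met with the open set attached to gr M modulo a homogeneous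
    submodule. *)
Lemma bdeg_le_assoc_graded (k : fieldType) (R : comNzRingType) (m : set R)
    (M : lmodType R) (G : comAlgType k) (Gg : nat -> set G) (s : nat -> R -> G)
    (N : gmodType G) (t : nat -> M -> N) (bdeg_gr : gmodType G -> nat)
    (adm : set M -> Prop) (V : set M -> set R) (beta : set M -> nat) :
  infinite_set [set: k] -> noetherian R -> ideal m -> fin_gen [set: M] ->
  assoc_graded_ring m Gg s -> (forall r, exists c : k, s 0%N r = c%:A) ->
  assoc_graded_module m s t -> graded_bdeg Gg bdeg_gr ->
  submodule_degree m adm V beta -> adm [set 0] ->
  (forall K n, adm K -> adm (sum_set K (pow_mod m n))) ->
  (forall K, adm K -> sat m K `<=` K -> K <> setT ->
     exists n (w : 'I_n -> G) O, [/\ zariski_open O, O !=set0,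
       forall i, Gg 1%N (w i),
       forall g, Gg 1%N g -> exists c, g = \sum_i c i *: w i
       & forall c, O c -> exists x,
           [/\ m x, V K x & s 1%N x = \sum_i c i *: w i]]) ->
  (beta [set 0%R] <= bdeg_gr N)%N.
Proof.
move=> kinf nR sm fgM agR s0 agM [U gU bax] dM adm0 adm_pow genM.
have catN : graded_module_cat Gg N.
  split; first exact: (assoc_module_fin_gen agR agM fgM).
  exact: (assoc_module_graded agR agM).
have [_ gN] := catN; have sG := assoc_ring_standard agR.
have [_ Ugen _] := gU.
(* The finite basis of G_1 is taken from the genericity condition for N. *)
have nG : noetherian G.
  have [_ _ [n [e [O [Be _ _ _]]]]] := Ugen N catN.
  exact: assoc_ring_noetherian agR s0 Be.
have [dN ->] := graded_submodule_degree nG sG catN gU bax.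
have nM := noetherian_fin_gen nR fgM.
rewrite -[[set 0] in leqRHS](initial_set0 agM).
apply: (degree_le_initial nR nG nM sm sG gN agR agM dM dN adm_pow _ adm0).
move=> K H aK satK KT hH.
have [n [w [O [oO O0 Gw span_w genK]]]] := genM K aK satK KT.
have catH : graded_module_cat Gg (quotg H).
  split; last exact: quotg_graded.
  by case: hH catN => sH _ [fgN _]; apply: fin_gen_quotient (quotm_classP sH)
    fgN.
have [_ _ [n' [e [O' [Be oO' O'0 genH]]]]] := Ugen _ catH.
have [c [c' [Oc O'c' E]]] := generic_common kinf oO O0 oO' O'0 Be Gw span_w.
have [x [mx Vx Ex]] := genK c Oc.
by exists x; split=> //; rewrite Ex E; apply: genH.
Qed.

(** m = m^2 forces m = 0 by Nakayama, so all of M is torsion. This excludes the case in which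
    [local_genericity] guarantees no generic elements. *)
Lemma sat_set0_of_idempotent (R : comNzRingType) (m : set R) (M : lmodType R) :
  noetherian R -> local_ring m -> m = pow_ideal m 2 -> sat m [set (0 : M)]
    = setT.
Proof.
move=> nR lm m2; have sm := local_ring_ideal lm.
have m0 : m `<=` [set 0].
  apply: (@nakayama R R^o m m nR sm _ sm) => [a|]; first exact: local_ring_unit.
  rewrite {1}m2; apply: smul_min => [|a b ma mb]; first exact: submodule_smul.
  by apply: mem_smul => //; apply: pow1_mem.
apply/seteqP; split=> // z _; exists 1%N => a /(pow1_mem sm) /m0 ->.
by rewrite scale0r.
Qed.

(** The class in degree 1 depends only on x modulo m^2, and the coefficients act through their
    classes in degree 0. *)
Lemma assoc_ring_lincomb (k : fieldType) (R : comNzRingType) (m : set R)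
    (G : comAlgType k) (Gg : nat -> set G) (s : nat -> R -> G) n
    (a : 'I_n -> R) (c : 'I_n -> k) (e : 'I_n -> R) x :
  ideal m -> assoc_graded_ring m Gg s ->
  (forall i, s 0%N (a i) = (c i)%:A) -> (forall i, m (e i)) ->
  pow_ideal m 2 (x - \sum_i a i * e i) ->
  s 1%N x = \sum_i c i *: s 1%N (e i).
Proof.
move=> sm agR sa me m2.
have m1e i : pow_ideal m 1 (a i * e i).
  by apply: mem_pow1; apply: (idealM _ sm).
rewrite -[x](subrK (\sum_i a i * e i)) (assoc_ringD agR).
- rewrite (assoc_ring_eq0 agR m2) add0r (assoc_ring_sum agR) //.
  apply: eq_bigr => i _; rewrite -mulr_algl -sa (assoc_ring_mul agR) //.
  exact: mem_pow1.
- exact: (@pow_modS_sub R R^o m 1).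
- exact: (submodule_sum (ideal_pow m 1)).
Qed.

Lemma irrelevant_mod2 (R : comNzRingType) (Rg : nat -> set R) x :
  standard_grading Rg -> irrelevant Rg x ->
  pow_ideal (irrelevant Rg) 2 (x - gproj Rg 1%N x).
Proof.
move=> sR /(irrelevantP sR) x0; have gR := std_grading sR.
have x1 := gproj_in gR 1%N x.
have [r [_ _ ->]] := gproj_decomp gR (x - gproj Rg 1%N x).
apply: (submodule_sum (ideal_pow _ 2)) => -[|[|i]] _.
- rewrite (gprojB gR) x0 (gproj_neq gR x1) // subrr.
  exact: (submodule0 (ideal_pow _ 2)).
- rewrite (gprojB gR) (gproj_id gR x1) subrr.
  exact: (submodule0 (ideal_pow _ 2)).
by apply: (@Rg_pow_irrelevant R Rg sR i.+2 2) => //; apply: gproj_in.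
Qed.

Theorem theorem6 (k : fieldType) (k_infinite : infinite_set [set: k]) :
  (forall (R : comNzRingType) (m : set R) (pi : {rmorphism R -> k})
          (M : lmodType R)
          (G : comAlgType k) (Gg : nat -> set G) (s : nat -> R -> G)
          (N : gmodType G) (t : nat -> M -> N)
          (bdeg : lmodType R -> nat) (bdeg_gr : gmodType G -> nat),
     noetherian R -> local_ring m -> residue_map m pi ->
     module_cat M ->
     assoc_graded_ring m Gg s -> (forall r : R, s 0%N r = (pi r)%:A) ->
     assoc_graded_module m s t ->
     local_bdeg m pi bdeg -> graded_bdeg Gg bdeg_gr ->
     (bdeg M <= bdeg_gr N)%N)
  /\
  (forall (R : comAlgType k) (Rg : nat -> set R)
          (M : gmodType R)
          (G : comAlgType k) (Gg : nat -> set G) (s : nat -> R -> G)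
          (N : gmodType G) (t : nat -> M -> N)
          (bdeg : gmodType R -> nat) (bdeg_gr : gmodType G -> nat),
     homogeneous_algebra Rg ->
     graded_module_cat Rg M ->
     assoc_graded_ring (irrelevant Rg) Gg s ->
     (forall c : k, s 0%N c%:A = c%:A) ->
     assoc_graded_module (irrelevant Rg) s t ->
     graded_bdeg Rg bdeg -> graded_bdeg Gg bdeg_gr ->
     (bdeg M <= bdeg_gr N)%N).
Proof.
split.
- move=> R m pi M G Gg s N t bdeg bdeg_gr nR lm [pi_surj _] fgM agR s0 agM.
  move=> [U gU bax] bgr; have sm := local_ring_ideal lm.
  have [dM ->] := local_submodule_degree nR sm fgM gU bax.
  have [_ Um _ Ugen _] := gU.
  apply: (bdeg_le_assoc_graded k_infinite nR sm fgM agR _ agM bgr dM).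
  + by move=> r; exists (pi r).
  + exact: submodule_set0.
  + by move=> K n sK; apply: submodule_sum_set => //; apply: submodule_pow_mod.
  move=> K sK satK KT.
  (* Otherwise everything is torsion, and a saturated K would be all of M. *)
  have mm2 : m <> pow_ideal m 2.
    move=> /(sat_set0_of_idempotent M nR lm) E; apply: KT; apply/seteqP;
      split=> // z _.
    apply: satK; apply: (@satS R m M [set 0]) => [_ ->|];
      first exact: submodule0.
    by rewrite E.
  have fgK : module_cat (quotm K) := fin_gen_quotient (quotm_classP sK) fgM.
  have [_ [n [e [O [[me span_e _] oO O0 genO]]]]] := Ugen mm2 _ fgK.
  have m1e i : pow_ideal m 1 (e i) by apply: mem_pow1.
  exists n, (fun i => s 1%N (e i)), O; split=> // [i|g|c Oc].
  + exact: (assoc_ring_in agR (m1e i)).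
  + case: (agR) => _ /(_ 1%N)[_ <- _] _ _ [x /(pow1_mem sm) mx <-].
    have [a m2a] := span_e x mx; exists (fun i => pi (a i)).
    exact: (assoc_ring_lincomb sm agR (a := a)).
  have /choice[a Ha] i : exists a, pi a = c i.
    by have: [set: k] (c i) by []; rewrite -pi_surj => -[a _ <-]; exists a.
  have [x Ux m2x] : exists2 x, U (quotm K)
    x & pow_ideal m 2 (x - \sum_i a i * e i).
    by apply: genO; rewrite (_ : (fun i => _) = c) //; apply/funext.
  exists x; split=> //; first by have [] := Um _ fgK _ Ux.
  by apply: (assoc_ring_lincomb sm agR (a := a)) => // i; rewrite s0 Ha.
move=> R Rg M G Gg s N t bdeg bdeg_gr hR catM agR s0 agM [U gU bax] bgr.
have sR := homogeneous_standard hR; have gR := std_grading sR.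
have sm := irrelevant_ideal sR; have [fgM gM] := catM.
have nR : noetherian R.
  have [_ _ _ [n [e [R1 _]]] genR] := hR.
  apply: (noetherian_algebra (xs := codom e)) => S S1 SL SM Se.
  apply: genR => //; rewrite R1 => _ [c _ <-].
  have S0 : S 0 by rewrite -[0](addNr 1) -scaleN1r; apply: SL.
  apply: (big_ind S) => // [x y Sx Sy|i _]; first by rewrite -[x]scale1r;
    apply: SL.
  by rewrite -[_ *: _]addr0; apply: SL => //; apply: Se; apply: codom_f.
have [dM ->] := graded_submodule_degree nR sR catM gU bax.
have [_ Ugen _] := gU.
apply: (bdeg_le_assoc_graded k_infinite nR sm fgM agR _ agM bgr dM).
(* r differs from its degree 0 component, which is a scalar, by an element of m, and [s 0] vanishes
   on m. *)
- move=> r; have [gR' _ R0 _ _] := hR.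
  have [c Ec] : exists c : k, gproj Rg 0%N r = c%:A.
    by have := gproj_in gR 0%N r; rewrite R0 => -[c _ <-]; exists c.
  exists c; rewrite -s0 -Ec -[in LHS](subrK (gproj Rg 0%N r) r).
  rewrite (assoc_ringD agR) // (assoc_ring_eq0 agR) ?add0r //.
  apply: mem_pow1; apply/(irrelevantP sR).
  by rewrite (gprojB gR) (gproj_id gR (gproj_in gR 0%N r)) subrr.
- exact: (homogeneous_submod_set0 gM).
- by move=> K n; apply: (homogeneous_submod_pow sR gM).
move=> K hK satK KT.
have catK : graded_module_cat Rg (quotg K).
  split; last exact: quotg_graded.
  by case: hK => sK _; apply: fin_gen_quotient (quotm_classP sK) fgM.
have [_ UR [n [e [O [[R1 free_e] oO O0 genO]]]]] := Ugen _ catK.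
have irr1 x : Rg 1%N x -> irrelevant Rg x by apply: Rg_irrelevant.
have R1e i : Rg 1%N (e i).
  rewrite R1; exists (fun j => (j == i)%:R) => //.
  rewrite (bigD1 i) //= eqxx scale1r big1 ?addr0 // => j /negbTE ->.
  by rewrite scale0r.
have algE (c : 'I_n -> k) : \sum_i c i *: e i = \sum_i (c i)%:A * e i.
  by apply: eq_bigr => i _; rewrite mulr_algl.
have mee i : irrelevant Rg (e i) by apply: irr1.
exists n, (fun i => s 1%N (e i)), O; split=> // [i|g|c Oc].
- exact: (assoc_ring_in agR (mem_pow1 (mee i))).
- case: (agR) => _ /(_ 1%N)[_ <- _] _ _ [x /(pow1_mem sm) mx <-].
  have := gproj_in gR 1%N x; rewrite R1 => -[c _ Ec]; exists c.
  apply: (assoc_ring_lincomb sm agR (a := fun i => (c i)%:A)) => //.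
  by rewrite -algE Ec; apply: irrelevant_mod2.
have Ux := genO c Oc; exists (\sum_i c i *: e i); split=> //.
  exact/irr1/(UR _ Ux).
apply: (assoc_ring_lincomb sm agR (a := fun i => (c i)%:A)) => //.
by rewrite -algE subrr; apply: (submodule0 (ideal_pow _ 2)).
Qed.
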